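(* In the setting described in the context, suppose that $f_\rho\in\mathscr{L}^2_{\rho_{\mathscr X}}$ with $\|f_\rho\|_{\mathscr{L}^2_{\rho_{\mathscr X}}}\le B_f$, and that $\sigma_\rho^2=\int_{\mathscr Z}(y-f_\rho(x))^2\,d\rho(x,y)\le B_\sigma^2$. Let $\gamma>0$, $\delta\in(0,1)$ and $N\ge 1$. Then, with confidence at least $1-\delta$ (i.e. with probability at least $1-\delta$ with respect to the draw of the $N$ independent samples from $\rho$), $$\|f_z-f_{\mathscr H}\|_{\mathscr{L}^2_{\rho_{\mathscr X}}}\le \frac{C_{\mathscr K}^3}{\gamma}\sqrt{\frac{B_f^2+B_\sigma^2}{\breve\lambda\,N\,\delta}},$$ where $\breve\lambda=\min_{i=1,\dots,E}\lambda_i$.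
   Context: Input/output spaces and measure. Let $X>0$, $\mathscr X=[-X/2,X/2]\subset\mathbb R$, $\mathscr Y=\mathbb R$, $\mathscr Z=\mathscr X\times\mathscr Y$. Let $\rho$ be a probability measure on $\mathscr Z$ whose marginal $\rho_{\mathscr X}$ on $\mathscr X$ is uniform, $d\rho_{\mathscr X}(x)=d\mu(x)/X$ with $\mu$ the Lebesgue measure, and with conditional distributions $\rho(y|x)$ on $\mathbb R$ (not assumed to have bounded support). The regression function is $f_\rho(x)=\int_{\mathscr Y}y\,d\rho(y|x)$. The space $\mathscr{L}^2_{\rho_{\mathscr X}}$ is the space of square-integrable functions on $\mathscr X$ with norm $\|f\|_{\mathscr{L}^2_{\rho_{\mathscr X}}}=\big(\int_{\mathscr X}f(x)^2\,d\rho_{\mathscr X}(x)\big)^{1/2}$. $B_f,B_\sigma\ge 0$ are constants. Hypothesis space. For integers $q\ge 1$ put $\bar\varphi^s_q(x)=\sqrt2\sin(2\pi qx/X)$ and $\bar\varphi^c_q(x)=\sqrt2\cos(2\pi qx/X)$. Let $E$ be a positive even integer, $Q=\{q_1,\dots,q_{E/2}\}$ a set of $E/2$ distinct positive integers, and for $j=1,\dots,E/2$ set $\varphi_j=\bar\varphi^s_{q_j}$, $\varphi_{j+E/2}=\bar\varphi^c_{q_j}$. Let $\phi(x)=[\varphi_1(x),\dots,\varphi_E(x)]^\top$ and $\Sigma_\alpha=\mathrm{diag}(\lambda_1,\dots,\lambda_E)$ with all $\lambda_i>0$. The kernel is $\mathscr K(x_a,x_b)=\phi(x_a)^\top\Sigma_\alpha\phi(x_b)$,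 and $C_{\mathscr K}=\sup_{x_a,x_b\in\mathscr X}\sqrt{|\mathscr K(x_a,x_b)|}$ $\big(=\sup_{x\in\mathscr X}\sqrt{\mathscr K(x,x)}\big)$. The associated reproducing kernel Hilbert space is $\mathscr H=\{f=\phi^\top(\cdot)\alpha:\alpha\in\mathbb R^E\}$ with norm $\|\phi^\top(\cdot)\alpha\|_{\mathscr H}^2=\alpha^\top\Sigma_\alpha^{-1}\alpha$. Estimators. Given $N$ independent samples $(x_1,y_1),\dots,(x_N,y_N)$ drawn from $\rho$ and $\gamma>0$, $$f_z=\arg\min_{f\in\mathscr H}\ \frac1N\sum_{t=1}^N(y_t-f(x_t))^2+\gamma\|f\|_{\mathscr H}^2,$$ $$f_{\mathscr H}=\arg\min_{f\in\mathscr H}\ \int_{\mathscr X}(f(x)-f_\rho(x))^2\,d\rho_{\mathscr X}(x)+\gamma\|f\|_{\mathscr H}^2 .$$ *)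

(* Defs.v *)
From HB Require Import structures.
From mathcomp Require Import all_boot all_order all_algebra.
From mathcomp Require Import all_classical all_reals all_analysis.

Set Implicit Arguments.
Unset Strict Implicit.
Unset Printing Implicit Defensive.

Import Order.TTheory GRing.Theory Num.Theory.
Import numFieldNormedType.Exports.

Local Open Scope classical_set_scope.
Local Open Scope ring_scope.

Section sampling.
Context d d' (Omega : measurableType d) (T : measurableType d') (R : realType).
Variables (P : probability Omega R) (N : nat) (Z : 'I_N -> {RV P >-> T}).

Definition mutually_independent : Prop :=
  forall (J : {set 'I_N}) (A : 'I_N -> set T),
    (forall t, t \in J -> measurable (A t)) ->
    P (\bigcap_(t in [set` J]) (Z t @^-1` A t)) =
    (\big[mule/1]_(t in J) P (Z t @^-1` A t))%E.

Definition iid_sample (rho : probability T R) : Prop :=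
  (forall t B, measurable B -> distribution P (Z t) B = rho B) /\
  mutually_independent.

End sampling.

Section regression.
Context (R : realType).
Local Notation RR := (measurableTypeR R).

Lemma X_lt (X : R) (hX : 0 < X) : - (X / 2) < X / 2.
Proof. by rewrite gtrN// divr_gt0. Qed.

Definition input_space (X : R) : set R := `[- (X / 2), X / 2]%classic.

(* The inputs are points of R almost surely in [input_space X], so that the
   joint law lives on R * R. *)
Definition uniform_input (X : R) (hX : 0 < X) : probability RR R :=
  uniform_prob (X_lt hX).

Definition uniform_marginal (X : R) (hX : 0 < X)
    (rho : probability (RR * RR)%type R) : Prop :=
  forall A : set RR, measurable A ->
    pushforward rho (fst : RR * RR -> RR) A = uniform_input hX A.

Definition is_conditional (X : R) (hX : 0 < X)
    (rho : probability (RR * RR)%type R) (kappa : R.-pker RR ~> RR) : Prop :=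
  forall A B : set RR, measurable A -> measurable B ->
    rho (A `*` B) = (\int[uniform_input hX]_(x in A) kappa x B)%E.

(* Junk-valued where y is not integrable for kappa x; finiteness of the noise
   variance below excludes this for almost every x. *)
Definition regression_fun (kappa : R.-pker RR ~> RR) (x : R) : R :=
  Rintegral (kappa x) [set: RR] (fun y => y).

Definition noise_variance (rho : probability (RR * RR)%type R)
    (frho : R -> R) : \bar R :=
  (\int[rho]_z ((z.2 - frho z.1) ^+ 2)%:E)%E.

End regression.

Section hypothesis_space.
Context (R : realType).

Definition sin_feature (X : R) (k : nat) (x : R) : R :=
  Num.sqrt 2 * sin (2 * pi * k%:R * x / X).

Definition cos_feature (X : R) (k : nat) (x : R) : R :=
  Num.sqrt 2 * cos (2 * pi * k%:R * x / X).

(* The even number E of features is m + m; q enumerates the frequencies. *)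
Definition feature (X : R) (m : nat) (q : 'I_m -> nat) (x : R) :
    'cV[R]_(m + m) :=
  col_mx (\col_i sin_feature X (q i) x) (\col_i cos_feature X (q i) x).

Section rkhs.
Variables (E : nat) (phi : R -> 'cV[R]_E) (lam : 'rV[R]_E).

Definition kernel_fun (xa xb : R) : R :=
  ((phi xa)^T *m diag_mx lam *m phi xb) 0 0.

Definition kernel_bound (D : set R) : R :=
  sup [set Num.sqrt `|kernel_fun x.1 x.2| | x in D `*` D].

Definition feature_comb (a : 'cV[R]_E) : R -> R :=
  fun x => ((phi x)^T *m a) 0 0.

Definition rkhs : set (R -> R) := range feature_comb.

(* Single-valued on [rkhs] when the features are linearly independent. *)
Definition rkhs_coord (f : R -> R) : 'cV[R]_E :=
  get [set a | feature_comb a = f].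

Definition rkhs_normsq (f : R -> R) : R :=
  ((rkhs_coord f)^T *m invmx (diag_mx lam) *m rkhs_coord f) 0 0.

End rkhs.

(* The regularised objectives below are strictly convex and coercive in the
   coordinates, so the choice made by [get] is the unique minimiser. *)
Definition argmin (H : set (R -> R)) (J : (R -> R) -> R) : R -> R :=
  get [set f | H f /\ forall g, H g -> J f <= J g].

Section estimators.
Variables (X : R) (hX : 0 < X) (E : nat) (phi : R -> 'cV[R]_E).
Variables (lam : 'rV[R]_E) (gamma : R).

Definition empirical_objective (N : nat) (z : 'I_N -> R * R) (f : R -> R) : R :=
  N%:R^-1 * (\sum_(t < N) ((z t).2 - f (z t).1) ^+ 2)
  + gamma * rkhs_normsq phi lam f.

Definition empirical_estimator (N : nat) (z : 'I_N -> R * R) : R -> R :=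
  argmin (rkhs phi) (empirical_objective z).

Definition population_objective (frho f : R -> R) : R :=
  Rintegral (uniform_input hX) (input_space X) (fun x => (f x - frho x) ^+ 2)
  + gamma * rkhs_normsq phi lam f.

Definition population_estimator (frho : R -> R) : R -> R :=
  argmin (rkhs phi) (population_objective frho).

End estimators.

Definition min_entry (m : nat) (hm : (0 < m)%N) (lam : 'rV[R]_(m + m)) : R :=
  let i0 := lshift m (Ordinal hm) in \big[Num.min/lam 0 i0]_i lam 0 i.

End hypothesis_space.

(* Main.v *)
Require Import Defs.
From HB Require Import structures.
From mathcomp Require Import all_boot all_order all_algebra.
From mathcomp Require Import all_classical all_reals all_analysis.
From mathcomp Require Import measurable_realfun ring lra.

Set Implicit Arguments.
Unset Strict Implicit.
Unset Printing Implicit Defensive.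

Import Order.TTheory GRing.Theory Num.Theory.
Import numFieldNormedType.Exports.

Local Open Scope classical_set_scope.
Local Open Scope ring_scope.

(** Write [|a|^2] for the penalty [\sum_i a_i ^ 2 / lam_i] of coordinates [a],
    [f_a] for the function they define, [G] and [b] for the Gram matrix of the
    features and their moments against [frho], and [G_z], [b_z] for the
    averages over the sample that replace them.  Both objectives are strictly
    convex quadratics of the coordinates, so the coordinates [aH] of [f_H] and
    [az] of [f_z] solve normal equations, with [L] the diagonal matrix of the
    [lam_i]:

      [(G + gamma L^-1) aH = b]   and   [(G_z + gamma L^-1) az = b_z].

    The first one says [gamma L^-1 aH = b - G aH].  Substituting it in the
    second one, the error [e = az - aH] satisfies
    [(G_z + gamma L^-1) e = Delta], where

      [Delta_i = N^-1 \sum_t phi_i(x_t) (y_t - f_H(x_t))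
                 - E[phi_i(x) (frho(x) - f_H(x))]].

    Pairing with [e], dropping the nonnegative term [e^T G_z e] and applying
    Cauchy-Schwarz with the weights [lam] gives
    [gamma^2 |e|^2 <= Q := \sum_i lam_i Delta_i^2] ([ridge_perturbation]).
    Since [f_e(x)^2 <= K(x, x) |e|^2 <= CK^2 |e|^2] on the input interval
    ([feature_comb_sqr_le], [kernel_le_bound]), the distance in L2 between the
    two estimators is at most [CK sqrt(Q) / gamma].

    It remains to bound [Q].  The noise [y - frho(x)] is orthogonal to every
    square-integrable function of [x] ([noise_orthogonal]), so [Delta_i] is the
    mean of [N] independent draws minus its expectation, and
    [E Q <= N^-1 E[K(x, x) (y - f_H(x))^2] <= N^-1 CK^2 (Bsigma^2 + Bf^2)]
    ([expected_deviation]): the residual splits orthogonally into the noise and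
    [frho - f_H], and the latter is not larger than [frho] in norm because
    [f_H] minimises the population objective ([population_bias_le]).  Markov's
    inequality now yields the bound [CK^2 / gamma] times
    [sqrt ((Bf^2 + Bsigma^2) / (N delta))], which implies the stated one because
    the smallest [lam_i] is at most [K(0, 0) <= CK^2].

    Two facts make this argument legitimate.  Coordinates are functions of the
    elements of the hypothesis space because the features are linearly
    independent ([feature_linearly_independent]); and the event has a
    probability because the coordinates of [f_z] are measurable functions of
    the sample ([measurable_ridge_coef]). *)

(** * Square-integrable functions and maps that transport a measure *)

Section square_integrable.
Context d (T : measurableType d) (R : realType).
Variable mu : {measure set T -> \bar R}.

(** Square integrability in terms of the integral of [f ^+ 2], free of the real
    powers that define the norm. *)
Lemma Lfun2P (f : T -> R) : f \in Lfun mu 2%:E <->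
  measurable_fun [set: T] f /\ (\int[mu]_x (f x ^+ 2)%:E < +oo)%E.
Proof.
have E : ('N[mu]_2%:E[EFin \o f] = (\int[mu]_x (f x ^+ 2)%:E) `^ 2^-1)%E.
  rewrite unlock /Lnorm; congr poweR; apply: eq_integral => x _ /=.
  by rewrite powR_mulrn// real_normK ?num_real.
split.
- rewrite inE => /andP[]; rewrite !inE/= => mf; rewrite /finite_norm E => lf.
  by split => //; apply: (@lty_poweRy _ _ 2^-1).
- move=> [mf lf]; rewrite inE; apply/andP; split; rewrite inE//=.
  by rewrite /finite_norm E poweR_lty.
Qed.

Lemma measurable_Lfun2 (f : T -> R) : f \in Lfun mu 2%:E ->
  measurable_fun [set: T] f.
Proof. by move=> /Lfun2P[]. Qed.

Lemma Lfun2D (f g : T -> R) : f \in Lfun mu 2%:E -> g \in Lfun mu 2%:E ->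
  f \+ g \in Lfun mu 2%:E.
Proof. by move=> Lf Lg; rewrite rpredD ?lee1n. Qed.

Lemma Lfun2B (f g : T -> R) : f \in Lfun mu 2%:E -> g \in Lfun mu 2%:E ->
  f \- g \in Lfun mu 2%:E.
Proof. by move=> Lf Lg; rewrite rpredB ?lee1n. Qed.

Lemma Lfun2_bounded_mul (M : R) (g f : T -> R) :
  measurable_fun [set: T] g -> (forall x, `|g x| <= M) ->
  f \in Lfun mu 2%:E -> g \* f \in Lfun mu 2%:E.
Proof.
move=> mg gM Lf; have [mf fi] := (Lfun2P f).1 Lf.
have M0 x : 0 <= M := le_trans (normr_ge0 (g x)) (gM x).
apply/Lfun2P; split; first exact: measurable_funM.
apply: (@le_lt_trans _ _ (\int[mu]_x ((M ^+ 2)%:E * (f x ^+ 2)%:E))%E).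
  apply: ge0_le_integral => //.
  - by move=> x _; rewrite lee_fin sqr_ge0.
  - by apply/measurable_EFinP; apply: measurable_funX; apply: measurable_funM.
  - apply/measurable_EFinP; apply: measurable_funM => //.
    exact: measurable_funX.
  - move=> x _; rewrite -EFinM lee_fin/= exprMn ler_wpM2r ?sqr_ge0//.
    by rewrite -(real_normK (num_real (g x))) ler_pXn2r ?nnegrE ?(M0 x).
rewrite ge0_integralZl_EFin ?sqr_ge0//.
- by rewrite lte_mul_pinfty ?lee_fin ?sqr_ge0.
- by move=> x _; rewrite lee_fin sqr_ge0.
- by apply/measurable_EFinP; apply: measurable_funX.
Qed.

Lemma Lfun2_integrableM (f g : T -> R) :
  f \in Lfun mu 2%:E -> g \in Lfun mu 2%:E ->
  mu.-integrable [set: T] (EFin \o (fun x => f x * g x)).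
Proof. by move=> Lf Lg; apply/Lfun1_integrable; exact: Lfun2_mul_Lfun1. Qed.

Lemma EFin_Rintegral_sqr (f : T -> R) : f \in Lfun mu 2%:E ->
  (\int[mu]_x (f x ^+ 2)%:E)%E = (\int[mu]_x (f x ^+ 2))%:E.
Proof.
move=> Lf; rewrite /Rintegral fineK//.
by apply: integrable_fin_num => //; exact: Lfun2_integrable_sqr.
Qed.

Lemma Lnorm2E (f : T -> R) : f \in Lfun mu 2%:E ->
  ('N[mu]_2%:E[EFin \o f] = (Num.sqrt (\int[mu]_x (f x ^+ 2))%R)%:E)%E.
Proof.
move=> Lf; rewrite unlock /Lnorm.
rewrite (_ : (\int[mu]_x _)%E = (\int[mu]_x (f x ^+ 2)%:E)%E); last first.
  apply: eq_integral => x _ /=.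
  by rewrite powR_mulrn// real_normK ?num_real.
rewrite EFin_Rintegral_sqr//= powR12_sqrt// Rintegral_ge0// => x _.
by rewrite sqr_ge0.
Qed.

End square_integrable.

Section measure_preserving.
Context d1 d2 (T1 : measurableType d1) (T2 : measurableType d2) (R : realType).
Variables (m1 : {measure set T1 -> \bar R}) (m2 : {measure set T2 -> \bar R}).
Variable phi : T1 -> T2.
Hypothesis mphi : measurable_fun [set: T1] phi.
Hypothesis phi_preserves : forall A, measurable A -> m1 (phi @^-1` A) = m2 A.

Lemma ge0_integral_preserving (f : T2 -> \bar R) :
  measurable_fun [set: T2] f -> (forall y, 0 <= f y)%E ->
  (\int[m2]_y f y = \int[m1]_x f (phi x))%E.
Proof.
move=> mf f0.
transitivity (\int[pushforward m1 phi]_y f y)%E.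
  apply: eq_measure_integral => A mA _.
  exact/esym/phi_preserves.
by rewrite ge0_integral_pushforward ?preimage_setT.
Qed.

(** The positive and the negative part are transported separately, so the formula
    covers divergent integrals too. *)
Lemma integral_preserving (f : T2 -> \bar R) :
  measurable_fun [set: T2] f ->
  (\int[m2]_y f y = \int[m1]_x f (phi x))%E.
Proof.
move=> mf; rewrite integralE [RHS]integralE; congr (_ - _)%E.
- rewrite (@ge0_integral_preserving (f^\+)%E)//; last exact: measurable_funepos.
  by apply: eq_integral => x _; rewrite !funeposE.
- rewrite (@ge0_integral_preserving (f^\-)%E)//; last exact: measurable_funeneg.
  by apply: eq_integral => x _; rewrite !funenegE.
Qed.

Lemma Rintegral_preserving (f : T2 -> R) : measurable_fun [set: T2] f ->
  \int[m2]_y f y = \int[m1]_x f (phi x).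
Proof.
by move=> mf; rewrite /Rintegral integral_preserving//; exact/measurable_EFinP.
Qed.

Lemma Lfun2_preserving (f : T2 -> R) :
  f \in Lfun m2 2%:E -> f \o phi \in Lfun m1 2%:E.
Proof.
move=> /Lfun2P[mf lf]; apply/Lfun2P; split; first exact: measurableT_comp.
rewrite -(@ge0_integral_preserving (fun y => (f y ^+ 2)%:E))//.
- by apply/measurable_EFinP; exact: measurable_funX.
- by move=> y; rewrite lee_fin sqr_ge0.
Qed.

End measure_preserving.

(** Markov's inequality read as a confidence statement.  The level [c] may be
    [0]: then [Q] has integral [0], so it vanishes almost surely, whereas
    dividing by [c] would say nothing. *)
Lemma markov_confidence d (T : measurableType d) (R : realType)
    (P : probability T R) (Q : T -> R) (c delta : R) :
  measurable_fun [set: T] Q -> (forall w, 0 <= Q w) -> 0 <= c -> 0 < delta ->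
  (\int[P]_w (Q w)%:E <= (delta * c)%:E)%E ->
  ((1 - delta)%:E <= P [set w | (Q w <= c)%R])%E.
Proof.
move=> mQ Q0 c0 d0 EQ.
have mQc : measurable [set w | Q w <= c].
  rewrite -[X in measurable X]setTI.
  exact: measurable_fun_le measurableT mQ (measurable_cst c).
have QE : [set w | Q w <= c] = ~` [set w | c < Q w].
  by apply/seteqP; split => w /=; rewrite leNgt => /negP.
have mcQ : measurable [set w | c < Q w].
  by rewrite -[X in measurable X]setCK -QE; exact: measurableC.
rewrite QE probability_setC//.
suff PQ : (P [set w | (c < Q w)%R] <= delta%:E)%E.
  by rewrite EFinB; exact: leeB.
have intQ : (\int[P]_w (Q w)%:E = \int[P]_w `|(Q w)%:E|)%E.
  by apply: eq_integral => w _; rewrite gee0_abs// lee_fin.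
move: c0; rewrite le_eqVlt => /predU1P[c0|c0].
  have /ae_eq_integral_abs : (\int[P]_w `|(Q w)%:E| = 0)%E.
    apply/eqP; rewrite -intQ eq_le integral_ge0 ?andbT//; last first.
      by move=> w _; rewrite lee_fin.
    by rewrite (le_trans EQ)// -c0 mulr0.
  move=> /(_ measurableT)[]; first exact/measurable_EFinP.
  move=> A [mA PA0 QA]; apply: (@le_trans _ _ (P A)).
    rewrite le_measure ?inE// => w /=; rewrite -c0 => Qw.
    by apply: QA => /= /(_ I) [] Qw0; rewrite Qw0 ltxx in Qw.
  by rewrite PA0 lee_fin ltW.
rewrite -(@lee_pmul2l _ c%:E)// -EFinM (mulrC c); apply: le_trans EQ.
have := @le_integral_abse _ _ _ P _ measurableT (EFin \o Q) c _ c0.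
rewrite intQ => /(_ (proj2 (measurable_EFinP _ _) mQ)); apply: le_trans.
rewrite lee_pmul2l//; apply: le_measure; rewrite ?inE//.
  apply: emeasurable_fun_c_infty => //.
  by do 2 apply: measurableT_comp => //.
by move=> w /= cQ; split => //; rewrite lee_fin ger0_norm// ltW.
Qed.

Section Rintegral_Lfun2.
Context d (T : measurableType d) (R : realType).
Variable mu : {measure set T -> \bar R}.

Lemma Rintegral_sum_mul (I : finType) (f : I -> T -> R) (c : I -> R)
    (g : T -> R) :
  (forall i, f i \in Lfun mu 2%:E) -> g \in Lfun mu 2%:E ->
  \int[mu]_x ((\sum_i c i * f i x) * g x) =
  \sum_i c i * \int[mu]_x (f i x * g x).
Proof.
move=> Lf Lg; rewrite /Rintegral.
have ifg i : mu.-integrable [set: T] (EFin \o (fun x => f i x * g x)).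
  exact: Lfun2_integrableM.
transitivity (fine (\int[mu]_x (\sum_i (c i)%:E * (f i x * g x)%:E)))%E.
  congr fine; apply: eq_integral => x _; rewrite mulr_suml -sumEFin.
  by apply: eq_bigr => i _; rewrite -EFinM mulrA.
rewrite (@integral_sum _ _ _ _ _ measurableT _
  (fun i x => ((c i)%:E * (f i x * g x)%:E)%E))//.
  rewrite (eq_bigr (fun i => (c i * fine (\int[mu]_x (f i x * g x)%:E))%:E)).
    by rewrite sumEFin.
  move=> i _; rewrite (@integralZl _ _ _ _ _ _ _ (ifg i))//.
  by rewrite EFinM fineK//; exact: integrable_fin_num (ifg i).
by move=> i; apply: integrableZl (ifg i).
Qed.

Lemma Lfun2_sum (I : finType) (f : I -> T -> R) (c : I -> R) :
  (forall i, f i \in Lfun mu 2%:E) ->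
  (fun x => \sum_i c i * f i x) \in Lfun mu 2%:E.
Proof.
move=> Lf.
rewrite (_ : (fun x => _) = \sum_i (c i \o* f i)%R); last first.
  by apply/funext => x; rewrite fct_sumE; apply: eq_bigr => i _; rewrite mulrC.
apply: (big_ind (fun h => h \in Lfun mu 2%:E)) => [|g h|i _].
- by rewrite rpred0 ?lee1n.
- exact: Lfun2D.
- by apply: Lfun_scale; rewrite ?ler1n.
Qed.

End Rintegral_Lfun2.

Section L2_expansion.
Context d (T : measurableType d) (R : realType) (mu : {measure set T -> \bar R}).

Lemma Rintegral_sqrB (u v : T -> R) :
  u \in Lfun mu 2%:E -> v \in Lfun mu 2%:E ->
  \int[mu]_x ((u x - v x) ^+ 2) =
  \int[mu]_x (u x * u x) - 2 * \int[mu]_x (u x * v x) + \int[mu]_x (v x * v x).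
Proof.
move=> Lu Lv.
have iuu := Lfun2_integrableM Lu Lu; have ivv := Lfun2_integrableM Lv Lv.
have iuv := Lfun2_integrableM Lu Lv.
have i2 : mu.-integrable [set: T] (EFin \o (fun x => 2 * (u x * v x))).
  exact: integrableZl iuv.
have iB := integrableB measurableT iuu i2.
rewrite -RintegralZl// -RintegralB// -RintegralD//.
by apply: eq_Rintegral => x _; ring.
Qed.

Lemma Rintegral_mulD (g u v : T -> R) :
  g \in Lfun mu 2%:E -> u \in Lfun mu 2%:E -> v \in Lfun mu 2%:E ->
  \int[mu]_x (g x * (u x + v x)) =
  \int[mu]_x (g x * u x) + \int[mu]_x (g x * v x).
Proof.
move=> Lg Lu Lv.
rewrite -(RintegralD _ (Lfun2_integrableM Lg Lu) (Lfun2_integrableM Lg Lv))//.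
by apply: eq_Rintegral => x _; rewrite mulrDr.
Qed.

End L2_expansion.

(** * Sample means of independent draws *)

Lemma Rintegral_prob_cst d (T : measurableType d) (R : realType)
    (P : probability T R) (c : R) : \int[P]_x c = c.
Proof.
rewrite Rintegral_cst//; transitivity (c * fine (1%:E : \bar R)).
  by congr (_ * fine _); exact: probability_setT.
by rewrite mulr1.
Qed.

Section sample_mean.
Context d d' (Omega : measurableType d) (T : measurableType d') (R : realType).
Variables (P : probability Omega R) (N : nat) (Z : 'I_N -> {RV P >-> T}).
Variable rho : probability T R.
Hypothesis hZ : iid_sample Z rho.

Let law t A : measurable A -> P (Z t @^-1` A) = rho A.
Proof. by move=> mA; exact: hZ.1. Qed.

(** The product rule for the events [Z s \in A] and [Z t \in B] fixes the joint
    law on rectangles, and rectangles determine a finite measure on the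
    product. *)
Lemma pair_law (s t : 'I_N) : s != t -> forall C, measurable C ->
  P ((fun w => (Z s w, Z t w)) @^-1` C) = (rho \x rho)%E C.
Proof.
move=> st C mC.
have mst : measurable_fun [set: Omega] (fun w => (Z s w, Z t w)).
  exact: measurable_fun_pair.
pose nu := pushforward P (fun w => (Z s w, Z t w)).
rewrite (product_measure_unique (m' := nu))//.
move=> A B mA mB; rewrite /nu /pushforward/=.
pose AB u := if u == s then A else B.
have mAB u : u \in [set s; t]%SET -> measurable (AB u) by rewrite /AB; case: ifP.
have := hZ.2 [set s; t]%SET AB mAB.
rewrite big_setU1/= ?finset.in_set1// big_set1 {2 3}/AB.
rewrite eqxx eq_sym (negbTE st) !law//.
move=> <-; congr (P _); apply/seteqP; split => w /=.
  move=> [Aw Bw] u; rewrite /= finset.in_set2 /AB => /orP[/eqP ->|/eqP ->].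
    by rewrite eqxx.
  by rewrite eq_sym (negbTE st).
move=> ABw; split.
  by have := ABw s; rewrite /= finset.in_set2 eqxx /AB eqxx; exact.
have := ABw t; rewrite /= finset.in_set2 eqxx orbT /AB eq_sym (negbTE st); exact.
Qed.

(** By [pair_law] this is a double integral of [eta a * eta b], whose inner
    integral vanishes. *)
Lemma centered_pair_uncorrelated (eta : T -> R) (s t : 'I_N) :
  eta \in Lfun rho 2%:E -> \int[rho]_a eta a = 0 -> s != t ->
  \int[P]_w (eta (Z s w) * eta (Z t w)) = 0.
Proof.
move=> Leta eta0 st.
have meta := measurable_Lfun2 Leta.
have LZ u : eta \o Z u \in Lfun P 2%:E.
  by apply: Lfun2_preserving Leta => //; exact: law.
pose f (ab : T * T) := eta ab.1 * eta ab.2.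
have mf : measurable_fun [set: T * T] f.
  by apply: measurable_funM; exact: measurableT_comp.
have mst : measurable_fun [set: Omega] (fun w => (Z s w, Z t w)).
  exact: measurable_fun_pair.
transitivity (\int[P]_w f (Z s w, Z t w)) => //.
rewrite -(Rintegral_preserving mst (pair_law st) mf).
have intf : (rho \x rho)%E.-integrable [set: T * T] (EFin \o f).
  apply/integrableP; split; first exact/measurable_EFinP.
  rewrite (ge0_integral_preserving mst (pair_law st))//; last first.
    by apply: measurableT_comp => //; exact/measurable_EFinP.
  by have /integrableP[] := Lfun2_integrableM (LZ s) (LZ t).
rewrite /Rintegral -integral12_prod_meas1//.
rewrite integral0_eq// => a _.
rewrite /fubini_F/= /f/=.
under eq_integral do rewrite EFinM.
rewrite integralZl//; last first.
  apply/Lfun1_integrable; apply: Lfun_subset12 Leta.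
  exact: fin_num_measure.
have i1 : rho.-integrable [set: T] (EFin \o eta).
  apply/Lfun1_integrable; apply: Lfun_subset12 Leta.
  exact: fin_num_measure.
rewrite -(fineK (integrable_fin_num _ i1))// -/(Rintegral _ _ _) eta0 mule0//.
Qed.

(** The cross terms of the squared sum vanish, which leaves [N] equal diagonal
    terms out of [N ^ 2], and the variance is at most the second moment. *)
Lemma sample_mean_variance (zeta : T -> R) : (0 < N)%N ->
  zeta \in Lfun rho 2%:E ->
  (\int[P]_w ((N%:R^-1 * \sum_(t < N) zeta (Z t w) - \int[rho]_a zeta a) ^+ 2)%:E
    <= (N%:R^-1 * \int[rho]_a (zeta a ^+ 2))%:E)%E.
Proof.
move=> N0 Lz.
set m := \int[rho]_a zeta a.
pose eta a := zeta a - m.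
have Leta : eta \in Lfun rho 2%:E.
  by rewrite (_ : eta = zeta \- cst m)//; apply: Lfun2B => //; exact: Lfun_cst.
have iz : rho.-integrable [set: T] (EFin \o zeta).
  by apply/Lfun1_integrable; apply: Lfun_subset12 Lz; exact: fin_num_measure.
have im c : rho.-integrable [set: T] (EFin \o cst (c : R)).
  exact: finite_measure_integrable_cst.
have eta0 : \int[rho]_a eta a = 0.
  rewrite RintegralB//; last exact: im.
  by rewrite Rintegral_prob_cst subrr.
have LZ u : eta \o Z u \in Lfun P 2%:E.
  by apply: Lfun2_preserving Leta => //; exact: law.
pose S w := \sum_t N%:R^-1 * (eta \o Z t) w.
have LS : S \in Lfun P 2%:E by exact: (Lfun2_sum (fun=> N%:R^-1) LZ).
have ES w : N%:R^-1 * \sum_(t < N) zeta (Z t w) - m = S w.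
  rewrite /S -mulr_sumr /= big_split/= sumrN sumr_const card_ord mulrDr.
  by rewrite mulrN -(mulr_natl m) mulKf// pnatr_eq0 -lt0n.
under eq_integral do rewrite ES.
rewrite EFin_Rintegral_sqr// lee_fin.
have -> : \int[P]_w (S w ^+ 2) = N%:R^-1 * \int[rho]_a (eta a ^+ 2).
  rewrite (_ : \int[P]_w _ = \int[P]_w (S w * S w)); last first.
    by apply: eq_Rintegral => w _; rewrite expr2.
  rewrite Rintegral_sum_mul//.
  rewrite (eq_bigr (fun t => N%:R^-1 * (N%:R^-1 * \int[rho]_a (eta a ^+ 2)))).
    by rewrite sumr_const card_ord -[_ *+ N]mulr_natl mulVKf// pnatr_eq0 -lt0n.
  move=> t _; congr (_ * _).
  rewrite (_ : \int[P]_w _ = \int[P]_w (S w * (eta \o Z t) w)); last first.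
    by apply: eq_Rintegral => w _; rewrite mulrC.
  rewrite Rintegral_sum_mul// (bigD1 t)//= big1 ?addr0; last first.
    by move=> s st; rewrite centered_pair_uncorrelated ?mulr0.
  congr (_ * _).
  rewrite (Rintegral_preserving (phi := Z t) (m1 := P)) //.
  - exact: law.
  - by apply: measurable_funX; exact: measurable_Lfun2 Leta.
rewrite ler_wpM2l ?invr_ge0//.
have -> : \int[rho]_a (eta a ^+ 2) = \int[rho]_a (zeta a ^+ 2) - m ^+ 2.
  rewrite (_ : \int[rho]_a (eta a ^+ 2) =
      \int[rho]_a (zeta a ^+ 2 - (2 * m * zeta a - m ^+ 2))); last first.
    by apply: eq_Rintegral => a _; rewrite /eta; ring.
  have i2 := Lfun2_integrable_sqr Lz.
  have imz : rho.-integrable [set: T] (EFin \o (fun a => 2 * m * zeta a)).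
    exact: integrableZl iz.
  rewrite RintegralB//; last exact: (integrableB measurableT imz (im (m ^+ 2))).
  rewrite RintegralB//; last exact: im.
  rewrite RintegralZl// Rintegral_prob_cst -/m; ring.
by rewrite lerBlDr lerDl sqr_ge0.
Qed.

End sample_mean.

(** * Integrating against a conditional distribution *)

Section disintegration.
Context d1 d2 (S : measurableType d1) (T : measurableType d2) (R : realType).
Variables (mu : probability S R) (kappa : R.-pker S ~> T).
Variable rho : probability (S * T)%type R.
Hypothesis rhoE : forall A B, measurable A -> measurable B ->
  rho (A `*` B) = (\int[mu]_(x in A) kappa x B)%E.

Let mpair (x : S) : measurable_fun [set: T] (pair x).
Proof. exact: pair1_measurable. Qed.

(** This kernel sends [x] to the law of [(x, y)] for [y] drawn from [kappa x].
    Composing it with [mu] turns [kcomp] into the measure on the product with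
    marginal [mu] and conditional distributions [kappa]; the unit coordinate is
    the source of the constant kernel [mu]. *)
Definition graph_kernel (ux : unit * S) : {measure set (S * T) -> \bar R}.
Proof.
refine (pushforward (kappa ux.2) (pair ux.2)).
exact: mpair.
Defined.

Let graph_kernel_measurable A : measurable A ->
  measurable_fun [set: unit * S] (graph_kernel ^~ A).
Proof.
move=> mA.
rewrite (_ : (fun _ => _) = (fun x => kappa x (xsection A x)) \o snd).
  apply: measurableT_comp => //.
  by apply: measurable_fun_xsection_finite_kernel; rewrite inE.
apply/funext => -[[] x] /=; congr (kappa x _).
by rewrite xsectionE.
Qed.

HB.instance Definition _ :=
  isKernel.Build _ _ _ _ _ graph_kernel graph_kernel_measurable.

Let graph_kernel_prob x : graph_kernel x [set: S * T] = 1%E.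
Proof. exact: prob_kernel. Qed.

HB.instance Definition _ :=
  Kernel_isProbability.Build _ _ _ _ _ graph_kernel graph_kernel_prob.

Let base_kernel := kprobability
  (measurable_cst (mu : pprobability S R) : measurable_fun [set: unit] _).

(** Equality on rectangles is the hypothesis [rhoE], and rectangles are closed
    under intersection and generate the product sigma-algebra. *)
Lemma disintegration_measure A : measurable A ->
  rho A = kcomp base_kernel graph_kernel tt A.
Proof.
pose G : set (set (S * T)) :=
  [set A `*` B | A in @measurable _ S & B in @measurable _ T].
pose nu : {measure set (S * T) -> \bar R} := kcomp base_kernel graph_kernel tt.
move=> mA; rewrite -/(nu A); apply: (measure_unique G (fun=> [set: S * T])) => //.
- by rewrite measurable_prod_measurableType.
- move=> _ _ [X1 mX1 [X2 mX2 <-]] [Y1 mY1 [Y2 mY2 <-]].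
  exists (X1 `&` Y1); first exact: measurableI.
  by exists (X2 `&` Y2); [exact: measurableI|rewrite setXI].
- by move=> _; exists setT => //; exists setT => //; rewrite setXTT.
- by rewrite bigcup_const//; exists 0%N.
- move=> _ [X mX [Y mY <-]]; apply: etrans (rhoE mX mY) _.
  rewrite /nu /kcomp/= integral_mkcond.
  apply: eq_integral => x _.
  transitivity (kappa x (xsection (X `*` Y) x)); last by rewrite xsectionE.
  rewrite patchE; case: ifPn => xX; first by rewrite in_xsectionX.
  by rewrite notin_xsectionX// measure0.
- by move=> _; apply: (@le_lt_trans _ _ 1%E); [exact: probability_le1|exact: ltry].
Qed.

Lemma ge0_integral_disintegration (f : S * T -> \bar R) :
  measurable_fun [set: S * T] f -> (forall z, 0 <= f z)%E ->
  (\int[rho]_z f z = \int[mu]_x \int[kappa x]_y f (x, y))%E.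
Proof.
move=> mf f0.
transitivity (\int[kcomp base_kernel graph_kernel tt]_z f z)%E.
  by apply: eq_measure_integral => A mA _; exact: disintegration_measure.
rewrite integral_kcomp//; apply: eq_integral => x _.
by rewrite /graph_kernel/= ge0_integral_pushforward ?preimage_setT.
Qed.

(** As [h] is integrable, so is [h (x, _)] for almost every [x], and for those
    [x] its positive and negative parts have equal integrals.  The
    disintegration formula, known for nonnegative functions only, is applied
    to the two parts of [h]. *)
Lemma integral_disintegration_eq0 (h : S * T -> R) :
  rho.-integrable [set: S * T] (EFin \o h) ->
  (forall x, (kappa x).-integrable [set: T] (fun y => (h (x, y))%:E) ->
     (\int[kappa x]_y (h (x, y))%:E = 0)%E) ->
  \int[rho]_z h z = 0.
Proof.
move=> ih h0; have /measurable_EFinP mh := measurable_int _ ih.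
have mhx x : measurable_fun [set: T] (fun y => (h (x, y))%:E).
  by apply/measurable_EFinP; exact: measurableT_comp.
rewrite /Rintegral integralE.
have mp := measurable_funepos (measurable_int _ ih).
have mn := measurable_funeneg (measurable_int _ ih).
rewrite (ge0_integral_disintegration mp)// (ge0_integral_disintegration mn)//.
pose F x := (\int[kappa x]_y `|(h (x, y))%:E|)%E.
have mF : measurable_fun [set: S] F.
  apply: (measurable_fun_integral_finite_kernel
    (fun z => `|(h z)%:E|%E) kappa) => //.
  by apply: measurableT_comp => //; exact/measurable_EFinP.
have iF : mu.-integrable [set: S] F.
  apply/integrableP; split => //.
  have /integrableP[_] := ih.
  rewrite (ge0_integral_disintegration (f := fun z => `|(EFin \o h) z|%E))//.
    move=> iF; apply: le_lt_trans iF; apply: ge0_le_integral => //.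
    - by apply: measurableT_comp.
    - by move=> x _; rewrite gee0_abs// integral_ge0.
  by apply: measurableT_comp => //; exact/measurable_EFinP.
rewrite (ae_eq_integral
  (fun x => \int[kappa x]_y (EFin \o h)^\- (x, y))%E) ?subee//.
- rewrite -ge0_integral_disintegration//; apply: integrable_neg_fin_num => //.
- exact: measurable_fun_integral_finite_kernel.
- exact: measurable_fun_integral_finite_kernel.
- have := integrable_ae measurableT iF; apply: filterS => x /(_ I) Fx _.
  have ihx : (kappa x).-integrable [set: T] (fun y => (h (x, y))%:E).
    apply/integrableP; split => //.
    by rewrite -ge0_fin_numE// integral_ge0.
  pose hx y := (h (x, y))%:E.
  have := h0 x ihx; rewrite integralE -/hx => /eqP.
  rewrite sube_eq ?add0e; last 2 first.
  + exact: integrable_pos_fin_num ihx.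
  + rewrite fin_num_adde_defl//; exact: integrable_neg_fin_num ihx.
  move=> /eqP E; transitivity (\int[kappa x]_y hx^\+ y)%E.
    by apply: eq_integral => y _; rewrite !funeposE.
  by rewrite E; apply: eq_integral => y _; rewrite !funenegE.
Qed.

(** If [g x] is nonzero, integrability of the integrand in [y] forces that of
    [Y], so that [f x] is a genuine mean and not the default value of a
    divergent integral; if [g x] is zero there is nothing to integrate. *)
Lemma conditionally_centered (f : S -> R) (Y : T -> R) (g : S -> R) :
  (forall x, f x = \int[kappa x]_y Y y) ->
  rho.-integrable [set: S * T] (EFin \o (fun z => g z.1 * (Y z.2 - f z.1))) ->
  \int[rho]_z (g z.1 * (Y z.2 - f z.1)) = 0.
Proof.
move=> fE ih.
rewrite (integral_disintegration_eq0 (h := fun z => g z.1 * (Y z.2 - f z.1)))//=.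
move=> x ix; have [g0|g0] := eqVneq (g x) 0.
  by rewrite integral0_eq// => y _; rewrite g0 mul0r.
have icst c : (kappa x).-integrable [set: T] (EFin \o cst (c : R)).
  apply/integrableP; split; first exact/measurable_EFinP/measurable_cst.
  rewrite (eq_integral (cst `|c|%:E))//.
  by rewrite integral_cst// prob_kernel mule1 ltry.
have iYf : (kappa x).-integrable [set: T] (fun y => (Y y - f x)%:E).
  apply: eq_integrable (integrableZl measurableT (g x)^-1 ix) => // y _.
  by rewrite /= -EFinM mulKf.
have iY : (kappa x).-integrable [set: T] (EFin \o Y).
  apply: eq_integrable (integrableD measurableT iYf (icst (f x))) => // y _.
  by rewrite /= -EFinD subrK.
under eq_integral do rewrite EFinM.
rewrite integralZl//.
under eq_integral do rewrite EFinB.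
have -> : (\int[kappa x]_y ((Y y)%:E - (f x)%:E) =
    \int[kappa x]_y (Y y)%:E - \int[kappa x]_y cst (f x)%:E y)%E.
  exact: (integralB measurableT iY (icst (f x))).
rewrite integral_cst// prob_kernel mule1.
by rewrite fE /Rintegral fineK ?subee ?mule0//; exact: integrable_fin_num.
Qed.

End disintegration.

(** * Regularised least squares in coordinates *)

Section ridge.
Context (R : realType) (E : nat) (phi : R -> 'cV[R]_E).

Lemma feature_combE (a : 'cV[R]_E) x :
  feature_comb phi a x = \sum_i a i 0 * phi x i 0.
Proof.
by rewrite /feature_comb mxE; apply: eq_bigr => i _; rewrite mxE mulrC.
Qed.

Lemma feature_combB (a b : 'cV[R]_E) x :
  feature_comb phi (a - b) x = feature_comb phi a x - feature_comb phi b x.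
Proof. by rewrite /feature_comb mulmxBr !mxE. Qed.

Definition linearly_independent := forall a, feature_comb phi a = cst 0 -> a = 0.

Lemma rkhs_coord_comb (a : 'cV[R]_E) : linearly_independent ->
  rkhs_coord phi (feature_comb phi a) = a.
Proof.
move=> li; apply: get_unique => // b /= ba.
apply/eqP; rewrite -subr_eq0; apply/eqP; apply: li; apply/funext => x.
by rewrite feature_combB ba subrr.
Qed.

Variable lam : 'rV[R]_E.
Hypothesis lam0 : forall i, 0 < lam 0 i.

Lemma invmx_diag (d : 'rV[R]_E) : (forall i, d 0 i != 0) ->
  invmx (diag_mx d) = diag_mx (\row_i (d 0 i)^-1).
Proof.
move=> d0.
have dV : diag_mx d *m diag_mx (\row_i (d 0 i)^-1) = 1%:M.
  apply/matrixP => i j; rewrite mul_diag_mx !mxE.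
  by case: eqVneq => [->|_]; rewrite ?mulr1n ?mulfV ?mulr0n ?mulr0.
have /mulmx1_unit[ud _] := dV.
by rewrite -[RHS](mulKmx ud) dV mulmx1.
Qed.

Lemma rkhs_normsq_comb (a : 'cV[R]_E) : linearly_independent ->
  rkhs_normsq phi lam (feature_comb phi a) = \sum_i a i 0 ^+ 2 / lam 0 i.
Proof.
move=> li; rewrite /rkhs_normsq rkhs_coord_comb// invmx_diag => [|i]; last first.
  by rewrite gt_eqF.
rewrite mul_mx_diag mxE; apply: eq_bigr => i _.
by rewrite !mxE mulrAC expr2.
Qed.

Lemma kernel_funE x y :
  kernel_fun phi lam x y = \sum_i lam 0 i * (phi x i 0 * phi y i 0).
Proof.
rewrite /kernel_fun mul_mx_diag mxE; apply: eq_bigr => i _.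
by rewrite !mxE mulrCA mulrA.
Qed.

End ridge.

Section quadratic_form.
Context (R : realType) (E : nat).
Implicit Types (M : 'M[R]_E) (a b : 'cV[R]_E).

Definition qform M a : R := (a^T *m M *m a) 0 0.
Definition dotc a b : R := (a^T *m b) 0 0.

Lemma dotcE a b : dotc a b = \sum_i a i 0 * b i 0.
Proof. by rewrite /dotc mxE; apply: eq_bigr => i _; rewrite mxE. Qed.

Lemma qformE M a : qform M a = \sum_i \sum_j a i 0 * a j 0 * M i j.
Proof.
rewrite /qform -mulmxA mxE; apply: eq_bigr => i _; rewrite !mxE mulr_sumr.
by apply: eq_bigr => j _; rewrite -mulrA [M i j * _]mulrC.
Qed.

Lemma qform_mulmx M a : qform M a = \sum_i a i 0 * (M *m a) i 0.
Proof. by rewrite /qform -mulmxA mxE; apply: eq_bigr => i _; rewrite mxE. Qed.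

(** A row vector [v] killed by [M] has [qform M v^T = 0], hence vanishes. *)
Lemma posdef_unitmx M : (forall a, a != 0 -> 0 < qform M a) -> M \in unitmx.
Proof.
move=> M0; rewrite -row_free_unit; apply: inj_row_free => v vM0.
have [//|v0] := eqVneq v 0.
have := M0 v^T; rewrite trmx_eq0 v0 /qform trmxK vM0 mul0mx mxE ltxx.
by move=> /(_ isT).
Qed.

(** Completing the square: [J] exceeds its value at [a0 = M^-1 b] by
    [qform M (a - a0)], so that [a0] is the only minimiser and [argmin] has no
    choice. *)
Lemma argmin_quadratic (phi : R -> 'cV[R]_E) M b c (J : (R -> R) -> R) :
  linearly_independent phi -> M^T = M ->
  (forall a, a != 0 -> 0 < qform M a) ->
  (forall a, J (feature_comb phi a) = qform M a - 2 * dotc a b + c) ->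
  argmin (rkhs phi) J = feature_comb phi (invmx M *m b).
Proof.
move=> li Ms M0 JE.
have [a0 <- Ma0] : exists2 a0, a0 = invmx M *m b & M *m a0 = b.
  by exists (invmx M *m b) => //; rewrite mulKVmx// posdef_unitmx.
have key a : J (feature_comb phi a) = J (feature_comb phi a0) + qform M (a - a0).
  rewrite !JE /qform /dotc -Ma0.
  have s1 : (a0^T *m (M *m a)) 0 0 = (a^T *m (M *m a0)) 0 0.
    transitivity ((a0^T *m (M *m a))^T 0 0); first by rewrite [RHS]mxE.
    by rewrite !trmx_mul trmxK Ms mulmxA.
  have B (u v : 'M[R]_1) : (u - v) 0 0 = u 0 0 - v 0 0 by rewrite !mxE.
  have trB : (a - a0)^T = a^T - a0^T by rewrite linearB.
  rewrite trB !mulmxBl !mulmxBr -!mulmxA !B {}s1; ring.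
apply: get_unique.
- split; first by exists a0.
  move=> _ [a _ <-]; rewrite (key a) lerDl.
  have [->|/M0/ltW//] := eqVneq (a - a0) 0.
  by rewrite /qform mulmx0 mxE.
- move=> _ [[a _ <-] /(_ (feature_comb phi a0))]; rewrite (key a) gerDl => H.
  have [/eqP|/M0] := eqVneq (a - a0) 0.
    by rewrite subr_eq0 => /eqP ->.
  by rewrite ltNge H//; exists a0.
Qed.

(** With [A], [B], [C] the three sums, [B * (A * B - C ^+ 2)] is the weighted sum
    of the squares of [B * u i - C * (lam i * v i)], hence nonnegative.  If
    [B = 0] then [v] vanishes. *)
Lemma cauchy_schwarz_weighted (I : finType) (lam u v : I -> R) :
  (forall i, 0 < lam i) ->
  (\sum_i u i * v i) ^+ 2 <=
    (\sum_i u i ^+ 2 / lam i) * (\sum_i lam i * v i ^+ 2).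
Proof.
move=> l0; set A := \sum_i u i ^+ 2 / _; set B := \sum_i _ * v i ^+ 2.
set C := \sum_i _.
have B0 : 0 <= B by apply: sumr_ge0 => i _; rewrite mulr_ge0 ?sqr_ge0 ?ltW.
have key : 0 <= B * (A * B - C ^+ 2).
  have -> : B * (A * B - C ^+ 2) =
      \sum_i (B * u i - C * (lam i * v i)) ^+ 2 / lam i.
    transitivity (\sum_i B ^+ 2 * (u i ^+ 2 / lam i) -
        \sum_i 2 * B * C * (u i * v i) + \sum_i C ^+ 2 * (lam i * v i ^+ 2)).
      by rewrite -!mulr_sumr -/A -/B -/C; ring.
    rewrite -sumrB -big_split/=; apply: eq_bigr => i _.
    by field; rewrite gt_eqF.
  by apply: sumr_ge0 => i _; rewrite divr_ge0 ?sqr_ge0 ?ltW.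
move: B0; rewrite le_eqVlt => /predU1P[B0|B0]; last first.
  by move: key; rewrite pmulr_rge0// subr_ge0.
have v0 i : v i = 0.
  have /eqP := esym B0; rewrite psumr_eq0 => [/allP/(_ i)|j _]; last first.
    by rewrite mulr_ge0 ?sqr_ge0 ?ltW.
  by rewrite mem_index_enum mulf_eq0 gt_eqF//= sqrf_eq0 => /(_ isT)/eqP.
rewrite /C big1 => [|i _]; last by rewrite v0 mulr0.
by rewrite expr0n/= -B0 mulr0.
Qed.

End quadratic_form.

Section ridge_coefficients.
Context (R : realType) (E : nat) (lam : 'rV[R]_E) (gamma : R).
Hypothesis lam_gt0 : forall i, 0 < lam 0 i.
Hypothesis gamma_gt0 : 0 < gamma.
Implicit Types (G : 'M[R]_E) (a b : 'cV[R]_E).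

Definition ridge_matrix G : 'M[R]_E :=
  G + gamma *: diag_mx (\row_i (lam 0 i)^-1).

Definition ridge_coef G b : 'cV[R]_E := invmx (ridge_matrix G) *m b.

Lemma qform_ridge_matrix G a :
  qform (ridge_matrix G) a = qform G a + gamma * \sum_i a i 0 ^+ 2 / lam 0 i.
Proof.
rewrite /qform /ridge_matrix mulmxDr mulmxDl mxE; congr (_ + _).
rewrite -scalemxAr -scalemxAl mxE mul_mx_diag mxE; congr (_ * _).
by apply: eq_bigr => i _; rewrite !mxE mulrAC expr2.
Qed.

Lemma penalty_ge0 a : 0 <= \sum_i a i 0 ^+ 2 / lam 0 i.
Proof. by apply: sumr_ge0 => i _; rewrite divr_ge0 ?sqr_ge0 ?ltW. Qed.

Lemma penalty_gt0 a : a != 0 -> 0 < \sum_i a i 0 ^+ 2 / lam 0 i.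
Proof.
move=> a0; rewrite lt0r penalty_ge0 andbT; apply: contra_neq a0.
move=> /eqP; rewrite psumr_eq0 => [/allP s0|i _]; last first.
  by rewrite divr_ge0 ?sqr_ge0 ?ltW.
apply/matrixP => i j; rewrite ord1 mxE; have := s0 i (mem_index_enum i).
by rewrite mulf_eq0 invr_eq0 (gt_eqF (lam_gt0 i)) orbF sqrf_eq0 => /eqP.
Qed.

Lemma ridge_matrix_posdef G a : (forall a, 0 <= qform G a) -> a != 0 ->
  0 < qform (ridge_matrix G) a.
Proof.
by move=> G0 a0; rewrite qform_ridge_matrix ltr_wpDl// mulr_gt0 ?penalty_gt0.
Qed.

Lemma ridge_matrix_unit G : (forall a, 0 <= qform G a) ->
  ridge_matrix G \in unitmx.
Proof. by move=> G0; apply: posdef_unitmx => a; exact: ridge_matrix_posdef. Qed.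

Lemma ridge_matrix_mulE G a i :
  (ridge_matrix G *m a) i 0 = (G *m a) i 0 + gamma * (a i 0 / lam 0 i).
Proof.
rewrite /ridge_matrix mulmxDl mxE -scalemxAl; congr (_ + _).
by rewrite mxE mul_diag_mx !mxE [_^-1 * _]mulrC.
Qed.

Lemma ridge_normal_equation G b i : (forall a, 0 <= qform G a) ->
  (G *m ridge_coef G b) i 0 + gamma * (ridge_coef G b i 0 / lam 0 i) = b i 0.
Proof.
by move=> G0; rewrite -ridge_matrix_mulE mulKVmx// ridge_matrix_unit.
Qed.

(** The penalty makes the quadratic strictly convex even when [G] is singular, as
    a Gram matrix built from fewer points than features is. *)
Lemma argmin_ridge (phi : R -> 'cV[R]_E) G b c (J : (R -> R) -> R) :
  linearly_independent phi -> G^T = G -> (forall a, 0 <= qform G a) ->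
  (forall a, J (feature_comb phi a) = qform G a - 2 * dotc a b + c
     + gamma * rkhs_normsq phi lam (feature_comb phi a)) ->
  argmin (rkhs phi) J = feature_comb phi (ridge_coef G b).
Proof.
move=> li Gs G0 JE; apply: (argmin_quadratic (c := c)) => //.
- by rewrite /ridge_matrix linearD/= linearZ/= tr_diag_mx Gs.
- by move=> a; exact: ridge_matrix_posdef.
- by move=> a; rewrite JE rkhs_normsq_comb// qform_ridge_matrix; ring.
Qed.

(** How far [a] is from solving the normal equations controls its distance to
    their solution.  The residual of [a] is the image of the error [e] under
    [ridge_matrix G]; paired with [e] it dominates [gamma] times the penalty of
    [e], and Cauchy-Schwarz bounds this pairing by the penalty of [e] and the
    dual norm of the residual. *)
Lemma ridge_perturbation G b a : (forall a, 0 <= qform G a) ->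
  gamma ^+ 2 * (\sum_i (ridge_coef G b - a) i 0 ^+ 2 / lam 0 i) <=
  \sum_i lam 0 i *
    (b i 0 - (G *m a) i 0 - gamma * (a i 0 / lam 0 i)) ^+ 2.
Proof.
move=> G0; set e := ridge_coef G b - a.
set h := \sum_i _ / _; set Q := \sum_i _.
pose r i := b i 0 - (G *m a) i 0 - gamma * (a i 0 / lam 0 i).
have rE i : r i = (ridge_matrix G *m e) i 0.
  have -> : (ridge_matrix G *m e) i 0 =
      (ridge_matrix G *m ridge_coef G b) i 0 - (ridge_matrix G *m a) i 0.
    by rewrite /e mulmxBr !mxE.
  by rewrite /r -(ridge_normal_equation b i G0) !ridge_matrix_mulE; ring.
have eMe : \sum_i e i 0 * r i = qform G e + gamma * h.
  rewrite -qform_ridge_matrix /qform -mulmxA mxE; apply: eq_bigr => i _.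
  by rewrite rE [e^T _ _]mxE.
have gh : gamma * h <= \sum_i e i 0 * r i by rewrite eMe lerDr.
have h0 : 0 <= h := penalty_ge0 e.
have := cauchy_schwarz_weighted (fun i => e i 0) r lam_gt0.
rewrite -/h -/Q => CS.
have : (gamma * h) ^+ 2 <= h * Q.
  apply: le_trans CS; rewrite ler_pXn2r// nnegrE ?mulr_ge0 ?(ltW gamma_gt0)//.
  by apply: le_trans gh; rewrite mulr_ge0 ?(ltW gamma_gt0).
move: h0; rewrite le_eqVlt => /predU1P[<- _|h0].
  by rewrite mulr0 sumr_ge0// => i _; rewrite mulr_ge0 ?sqr_ge0 ?ltW.
by rewrite exprMn [h ^+ 2]expr2 mulrA [_ * h]mulrC ler_pM2l.
Qed.

End ridge_coefficients.

(** * Trigonometric features *)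

Section trigonometric_features.
Context (R : realType) (X : R) (hX : 0 < X) (m : nat) (q : 'I_m -> nat).

Let phi := feature X q.

Lemma feature_lshift i x : phi x (lshift m i) 0 = sin_feature X (q i) x.
Proof. by rewrite /phi /feature col_mxEu mxE. Qed.

Lemma feature_rshift i x : phi x (rshift m i) 0 = cos_feature X (q i) x.
Proof. by rewrite /phi /feature col_mxEd mxE. Qed.

Lemma feature_bounded i x : `|phi x i 0| <= Num.sqrt 2.
Proof.
case: (splitP i) => j ij.
  rewrite (_ : i = lshift m j) ?feature_lshift; last exact: val_inj.
  rewrite normrM ger0_norm ?sqrtr_ge0// ler_piMr ?sqrtr_ge0//.
  by rewrite ler_norml sin_le1 sin_geN1.
rewrite (_ : i = rshift m j) ?feature_rshift; last exact: val_inj.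
rewrite normrM ger0_norm ?sqrtr_ge0// ler_piMr ?sqrtr_ge0//.
by rewrite ler_norml cos_le1 cos_geN1.
Qed.

Lemma measurable_feature i : measurable_fun [set: R] (fun x => phi x i 0).
Proof.
have lin c : measurable_fun [set: R] (fun x : R => 2 * pi * c * x / X).
  by apply: measurable_funM => //; apply: measurable_funM.
case: (splitP i) => j ij.
  rewrite (_ : i = lshift m j); last exact: val_inj.
  rewrite (_ : (fun x => _) = sin_feature X (q j)); last first.
    by apply/funext => x; exact: feature_lshift.
  apply: measurable_funM => //; apply: measurableT_comp => //.
  exact: continuous_measurable_fun (@continuous_sin R).
rewrite (_ : i = rshift m j); last exact: val_inj.
rewrite (_ : (fun x => _) = cos_feature X (q j)); last first.
  by apply/funext => x; exact: feature_rshift.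
apply: measurable_funM => //; apply: measurableT_comp => //.
exact: continuous_measurable_fun (@continuous_cos R).
Qed.

(** Sine and cosine of the same frequency are eigenfunctions of
    [f |-> f (_ + h) + f (_ - h)] for the same eigenvalue. *)
Lemma sin_feature_second_difference k x h :
  sin_feature X k (x + h) + sin_feature X k (x - h) =
  2 * cos (2 * pi * k%:R * h / X) * sin_feature X k x.
Proof.
rewrite /sin_feature mulrDr mulrBr mulrDl mulrBl sinD sinB; ring.
Qed.

Lemma cos_feature_second_difference k x h :
  cos_feature X k (x + h) + cos_feature X k (x - h) =
  2 * cos (2 * pi * k%:R * h / X) * cos_feature X k x.
Proof.
rewrite /cos_feature mulrDr mulrBr mulrDl mulrBl cosD cosB; ring.
Qed.

Hypothesis q_gt0 : forall i, (0 < q i)%N.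
Hypothesis q_inj : injective q.

Let step := X / 2 / (\max_i q i)%:R.
Let mu i := 2 * cos (2 * pi * (q i)%:R * step / X).

(** For this step the angles are [pi * q i / \max_i q i], in the range [[0, pi]]
    where the cosine is injective: distinct frequencies have distinct
    eigenvalues. *)
Let mu_inj : injective mu.
Proof.
have pi0 : 0 < pi :> R := pi_gt0 R.
have two0 : 2 != 0 :> R by rewrite pnatr_eq0.
move=> i j /(mulfI two0) cij; apply: q_inj.
have M0 : 0 < (\max_i q i)%:R :> R.
  by rewrite ltr0n (leq_trans (q_gt0 i))// leq_bigmax.
have angle k : 2 * pi * (q k)%:R * step / X = pi * ((q k)%:R / (\max_i q i)%:R).
  by rewrite /step; field; rewrite !gt_eqF.
have angle_itv k : 2 * pi * (q k)%:R * step / X \in `[0, pi].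
  rewrite angle in_itv/=; apply/andP; split.
    by rewrite mulr_ge0 ?divr_ge0 ?(ltW pi0).
  by rewrite ler_piMr ?(ltW pi0)// ler_pdivrMr// mul1r ler_nat leq_bigmax.
have := cos_inj (angle_itv i) (angle_itv j) cij; rewrite !angle.
move=> /(mulfI (lt0r_neq0 pi0))/(divIf (lt0r_neq0 M0)) /eqP.
by rewrite eqr_nat => /eqP.
Qed.

(** Group a vanishing combination by frequencies into [\sum_i g i x = 0].  As
    [g i] is an eigenfunction of the second difference for [mu i], iterating
    gives [\sum_i p.[mu i] * g i x = 0] for every polynomial [p]; a [p] with
    roots at all the other eigenvalues isolates [g i].  Evaluation at [0] and
    at a quarter of a period then kills the two coefficients of [g i]. *)
Lemma feature_linearly_independent : linearly_independent phi.
Proof.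
move=> a a0.
pose g i x := a (lshift m i) 0 * sin_feature X (q i) x +
              a (rshift m i) 0 * cos_feature X (q i) x.
have sum_g x : \sum_i g i x = 0.
  transitivity (feature_comb phi a x); last by rewrite a0.
  rewrite feature_combE big_split_ord/= -big_split/=; apply: eq_bigr => i _.
  by rewrite feature_lshift feature_rshift.
have g_step i x : g i (x + step) + g i (x - step) = mu i * g i x.
  transitivity
    (a (lshift m i) 0 * (sin_feature X (q i) (x + step) +
                         sin_feature X (q i) (x - step)) +
     a (rshift m i) 0 * (cos_feature X (q i) (x + step) +
                         cos_feature X (q i) (x - step))).
    by rewrite /g; ring.
  rewrite sin_feature_second_difference cos_feature_second_difference -/(mu i).
  by rewrite /g; ring.
have poly_g (p : {poly R}) x : \sum_i p.[mu i] * g i x = 0.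
  elim/poly_ind: p x => [|p c IH] x.
    by rewrite big1// => i _; rewrite horner0 mul0r.
  transitivity (\sum_i (p.[mu i] * g i (x + step) +
      p.[mu i] * g i (x - step) + c * g i x)).
    apply: eq_bigr => i _; rewrite hornerMXaddC -mulrDr g_step; ring.
  by rewrite !big_split/= !IH -mulr_sumr sum_g mulr0 !addr0.
have g0 i x : g i x = 0.
  pose p := \prod_(j | j != i) ('X - (mu j)%:P).
  have := poly_g p x; rewrite (bigD1 i)//= big1 ?addr0 => [|j ji].
    move/eqP; rewrite mulf_eq0 => /orP[|/eqP//].
    rewrite horner_prod prodf_seq_eq0 => /hasP[j _ /andP[ji]].
    by rewrite hornerXsubC subr_eq0 => /eqP/mu_inj ij; rewrite ij eqxx in ji.
  rewrite horner_prod (bigD1 j)//= hornerXsubC subrr mul0r mul0r//.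
have s2 : Num.sqrt 2 != 0 :> R by rewrite sqrtr_eq0 -ltNge.
have ar i : a (rshift m i) 0 = 0.
  have := g0 i 0; rewrite /g /sin_feature /cos_feature mulr0 mul0r sin0 cos0.
  by rewrite !mulr0 add0r mulr1 => /eqP; rewrite mulf_eq0 (negbTE s2) orbF => /eqP.
have al i : a (lshift m i) 0 = 0.
  (* a quarter of the period [X / q i], where the sine equals [1] *)
  have := g0 i (X / 4 / (q i)%:R); rewrite /g ar mul0r addr0 /sin_feature.
  rewrite (_ : 2 * pi * _ * _ / X = pi / 2).
    rewrite sin_pihalf mulr1 => /eqP.
    by rewrite mulf_eq0 (negbTE s2) orbF => /eqP.
  by field; rewrite pnatr_eq0 -lt0n q_gt0 gt_eqF.
apply/matrixP => i j; rewrite ord1 mxE.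
case: (splitP i) => k ik.
  by rewrite (_ : i = lshift m k) ?al//; exact: val_inj.
by rewrite (_ : i = rshift m k) ?ar//; exact: val_inj.
Qed.

End trigonometric_features.

(** * Measurable dependence of ridge coefficients on the data *)

Section measurable_inverse.
Context d (T : measurableType d) (R : realType).

(** The identity [t^-1 = t * (t ^+ 2) `^ (-1)] holds at [0] as well and reduces
    inversion to a measurable power function. *)
Lemma measurable_funV (f : T -> R) : measurable_fun [set: T] f ->
  measurable_fun [set: T] (fun x => (f x)^-1).
Proof.
move=> mf; rewrite (_ : (fun x => _) = fun x => f x * (f x ^+ 2) `^ (-1)).
  apply: measurable_funM => //.
  apply: (measurableT_comp (measurable_powR _)).
  exact: measurable_funX.
apply/funext => x; rewrite powR_inv1 ?sqr_ge0//.
have [->|fx0] := eqVneq (f x) 0; first by rewrite invr0 mul0r.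
by rewrite expr2 invfM mulrA mulfV ?mul1r.
Qed.

Lemma measurable_det n (A : T -> 'M[R]_n) :
  (forall i j, measurable_fun [set: T] (fun x => A x i j)) ->
  measurable_fun [set: T] (fun x => \det (A x)).
Proof.
move=> mA; rewrite /determinant; apply: measurable_sum => s.
by apply: measurable_funM => //; apply: measurable_prod => i _.
Qed.

(** By Cramer's rule. *)
Lemma measurable_invmx n (A : T -> 'M[R]_n) i j :
  (forall x, A x \in unitmx) ->
  (forall i j, measurable_fun [set: T] (fun x => A x i j)) ->
  measurable_fun [set: T] (fun x => invmx (A x) i j).
Proof.
move=> uA mA.
rewrite (_ : (fun x => _) = fun x => (\det (A x))^-1 *
    ((-1) ^+ (j + i) * \det (row' j (col' i (A x))))); last first.
  by apply/funext => x; rewrite /invmx uA !mxE.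
apply: measurable_funM; first exact/measurable_funV/measurable_det.
apply: measurable_funM => //; apply: measurable_det => k l.
rewrite (_ : (fun x => _) = fun x => A x (lift j k) (lift i l)) //.
by apply/funext => x; rewrite !mxE.
Qed.

Lemma measurable_ridge_coef n (lam : 'rV[R]_n) gamma (G : T -> 'M[R]_n)
    (b : T -> 'cV[R]_n) i :
  (forall i, 0 < lam 0 i) -> 0 < gamma ->
  (forall x a, 0 <= qform (G x) a) ->
  (forall i j, measurable_fun [set: T] (fun x => G x i j)) ->
  (forall i, measurable_fun [set: T] (fun x => b x i 0)) ->
  measurable_fun [set: T] (fun x => ridge_coef lam gamma (G x) (b x) i 0).
Proof.
move=> l0 g0 G0 mG mb; under eq_fun do rewrite mxE.
apply: measurable_sum => j; apply: measurable_funM => //.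
apply: measurable_invmx => [x|k l]; first exact: ridge_matrix_unit.
rewrite (_ : (fun x => _) = fun x => G x k l +
    gamma * diag_mx (\row_i (lam 0 i)^-1) k l); last first.
  by apply/funext => x; rewrite !mxE.
by apply: measurable_funD.
Qed.

End measurable_inverse.

(** * The kernel on the diagonal *)

Section kernel_bound.
Context (R : realType) (E : nat) (phi : R -> 'cV[R]_E) (lam : 'rV[R]_E).
Hypothesis lam_gt0 : forall i, 0 < lam 0 i.

Lemma kernel_diag_ge0 x : 0 <= kernel_fun phi lam x x.
Proof.
rewrite kernel_funE sumr_ge0// => i _.
by rewrite mulr_ge0 ?(ltW (lam_gt0 i))// -expr2 sqr_ge0.
Qed.

Variable B : R.
Hypothesis phiB : forall i x, `|phi x i 0| <= B.

(** Bounded features keep the supremum that defines [kernel_bound] finite; the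
    supremum of an unbounded set would be the default value [0]. *)
Lemma sqrt_kernel_le_bound (D : set R) x : D x ->
  Num.sqrt (kernel_fun phi lam x x) <= kernel_bound phi lam D.
Proof.
move=> Dx.
have K0 := kernel_diag_ge0 x.
rewrite /kernel_bound; apply: ub_le_sup; last first.
  by exists (x, x) => //=; rewrite ger0_norm.
exists (Num.sqrt (\sum_i lam 0 i * (B * B))) => _ [[y z] _ <-] /=.
apply: ler_wsqrtr; rewrite kernel_funE (le_trans (ler_norm_sum _ _ _))//.
apply: ler_sum => i _.
by rewrite !normrM gtr0_norm// ler_wpM2l ?(ltW (lam_gt0 i))// ler_pM.
Qed.

Lemma kernel_bound_ge0 (D : set R) x : D x -> 0 <= kernel_bound phi lam D.
Proof. by move=> /sqrt_kernel_le_bound; apply: le_trans; exact: sqrtr_ge0. Qed.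

Lemma kernel_le_bound (D : set R) x : D x ->
  kernel_fun phi lam x x <= kernel_bound phi lam D ^+ 2.
Proof.
move=> Dx; rewrite -[leLHS]sqr_sqrtr ?kernel_diag_ge0//.
rewrite ler_pXn2r ?nnegrE ?sqrtr_ge0 ?(kernel_bound_ge0 Dx)//.
exact: sqrt_kernel_le_bound.
Qed.

(** The reproducing property, as Cauchy-Schwarz in coordinates. *)
Lemma feature_comb_sqr_le a x :
  feature_comb phi a x ^+ 2 <=
    kernel_fun phi lam x x * \sum_i a i 0 ^+ 2 / lam 0 i.
Proof.
rewrite feature_combE kernel_funE mulrC.
rewrite [X in _ * X](eq_bigr (fun i => lam 0 i * phi x i 0 ^+ 2)); last first.
  by move=> i _; rewrite expr2.
exact: cauchy_schwarz_weighted (fun i => a i 0) (fun i => phi x i 0) lam_gt0.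
Qed.

End kernel_bound.

Lemma input_space0 (R : realType) (X : R) : 0 < X -> input_space X 0.
Proof.
by move=> hX; rewrite /input_space/= in_itv/= oppr_le0 !divr_ge0 ?ltW.
Qed.

Section smallest_weight.
Context (R : realType) (m : nat) (hm : (0 < m)%N) (lam : 'rV[R]_(m + m)).
Hypothesis lam_gt0 : forall i, 0 < lam 0 i.

Lemma min_entry_gt0 : 0 < min_entry hm lam.
Proof. by rewrite /min_entry; apply: lt_bigmin. Qed.

Lemma min_entry_le i : min_entry hm lam <= lam 0 i.
Proof. by rewrite /min_entry; apply: bigmin_le_cond. Qed.

(** Only the cosines survive at [x = 0], where each contributes twice its weight
    to the kernel. *)
Lemma min_entry_le_kernel_bound (X : R) (q : 'I_m -> nat) : 0 < X ->
  min_entry hm lam <= kernel_bound (feature X q) lam (input_space X) ^+ 2.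
Proof.
move=> hX; apply: (@le_trans _ _ (kernel_fun (feature X q) lam 0 0)); last first.
  apply: (kernel_le_bound lam_gt0 (fun i x => feature_bounded X q i x)).
  exact: input_space0.
rewrite kernel_funE (bigD1 (rshift m (Ordinal hm)))//=.
rewrite feature_rshift /cos_feature mulr0 mul0r cos0 mulr1 -expr2 sqr_sqrtr//.
apply: ler_wpDr.
  by apply: sumr_ge0 => i _; rewrite mulr_ge0 ?(ltW (lam_gt0 i))// -expr2 sqr_ge0.
apply: le_trans (min_entry_le (rshift m (Ordinal hm))) _.
by rewrite ler_peMr ?(ltW (lam_gt0 _))// ler1n.
Qed.

End smallest_weight.

(** * The empirical and the population estimator *)

Section uniform_input.
Context (R : realType) (X : R) (hX : 0 < X).
Local Notation mu := (uniform_input hX).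

Lemma measurable_input_space : measurable (input_space X : set (measurableTypeR R)).
Proof. exact: measurable_itv. Qed.

Lemma uniform_input_outside : mu (~` input_space X) = 0%E.
Proof.
rewrite /uniform_input/= /uniform_prob integral0_eq// => x xD.
rewrite /uniform_pdf ifF//; apply/negbTE/negP => xI; apply: xD.
by rewrite /input_space/= in_itv.
Qed.

(** The uniform distribution is carried by the interval, so that integrals over
    the line and over the interval agree. *)
Lemma integral_input_space (g : R -> \bar R) : measurable_fun [set: R] g ->
  (\int[mu]_(x in input_space X) g x = \int[mu]_x g x)%E.
Proof.
move=> mg; rewrite integral_mkcond; apply: ae_eq_integral => //.
  apply/measurable_restrict => //; first exact: measurable_input_space.
  exact: measurable_funS mg.
exists (~` input_space X); split.
- by apply: measurableC; exact: measurable_input_space.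
- exact: uniform_input_outside.
- move=> x /= xN xD; apply: xN => _.
  by rewrite patchE ifT// inE.
Qed.

End uniform_input.

Section estimators.
Context (R : realType) (E : nat) (phi : R -> 'cV[R]_E) (lam : 'rV[R]_E).
Variable gamma : R.
Hypothesis phi_li : linearly_independent phi.
Hypothesis lam_gt0 : forall i, 0 < lam 0 i.
Hypothesis gamma_gt0 : 0 < gamma.

Section empirical.
Variables (N : nat) (z : 'I_N -> R * R).

Definition empirical_gram : 'M[R]_E :=
  \matrix_(i, j) (N%:R^-1 * \sum_t phi (z t).1 i 0 * phi (z t).1 j 0).

Definition empirical_cross : 'cV[R]_E :=
  \col_i (N%:R^-1 * \sum_t phi (z t).1 i 0 * (z t).2).

Lemma empirical_gram_mul a i : (empirical_gram *m a) i 0 =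
  N%:R^-1 * \sum_t phi (z t).1 i 0 * feature_comb phi a (z t).1.
Proof.
rewrite mxE (eq_bigr (fun j => \sum_t N%:R^-1 *
    (phi (z t).1 i 0 * (a j 0 * phi (z t).1 j 0)))); last first.
  move=> j _; rewrite mxE -mulrA mulr_suml mulr_sumr; apply: eq_bigr => t _.
  by ring.
rewrite exchange_big/= mulr_sumr; apply: eq_bigr => t _.
by rewrite -mulr_sumr -mulr_sumr feature_combE.
Qed.

Lemma qform_empirical_gram a : qform empirical_gram a =
  N%:R^-1 * \sum_t feature_comb phi a (z t).1 ^+ 2.
Proof.
rewrite qform_mulmx (eq_bigr (fun i => \sum_t N%:R^-1 *
    (a i 0 * phi (z t).1 i 0 * feature_comb phi a (z t).1))); last first.
  move=> i _; rewrite empirical_gram_mul !mulr_sumr; apply: eq_bigr => t _.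
  by ring.
rewrite exchange_big/= mulr_sumr; apply: eq_bigr => t _.
by rewrite -mulr_sumr -mulr_suml -feature_combE expr2.
Qed.

Lemma qform_empirical_gram_ge0 a : 0 <= qform empirical_gram a.
Proof.
rewrite qform_empirical_gram mulr_ge0 ?invr_ge0//.
by rewrite sumr_ge0// => t _; rewrite sqr_ge0.
Qed.

Lemma dotc_empirical_cross a : dotc a empirical_cross =
  N%:R^-1 * \sum_t feature_comb phi a (z t).1 * (z t).2.
Proof.
rewrite dotcE (eq_bigr (fun i => \sum_t N%:R^-1 *
    (a i 0 * phi (z t).1 i 0 * (z t).2))); last first.
  by move=> i _; rewrite mxE !mulr_sumr; apply: eq_bigr => t _; ring.
rewrite exchange_big/= mulr_sumr; apply: eq_bigr => t _.
by rewrite -mulr_sumr -mulr_suml -feature_combE.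
Qed.

Lemma empirical_estimatorE : empirical_estimator phi lam gamma z =
  feature_comb phi (ridge_coef lam gamma empirical_gram empirical_cross).
Proof.
apply: (argmin_ridge lam_gt0 gamma_gt0 (c := N%:R^-1 * \sum_t (z t).2 ^+ 2)) => //.
- apply/matrixP => i j; rewrite !mxE; congr (_ * _).
  by apply: eq_bigr => t _; rewrite mulrC.
- exact: qform_empirical_gram_ge0.
- move=> a; rewrite /empirical_objective; congr (_ + _).
  rewrite qform_empirical_gram dotc_empirical_cross mulrCA -mulrBr -mulrDr.
  congr (_ * _); rewrite mulr_sumr -sumrB -big_split/=.
  by apply: eq_bigr => t _; ring.
Qed.

End empirical.

Section population.
Variables (X : R) (hX : 0 < X) (frho : R -> R).
Local Notation mu := (uniform_input hX).
Hypothesis Lphi : forall i, (fun x => phi x i 0) \in Lfun mu 2%:E.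
Hypothesis Lfrho : frho \in Lfun mu 2%:E.

Definition gram : 'M[R]_E :=
  \matrix_(i, j) \int[mu]_x (phi x i 0 * phi x j 0).

Definition cross : 'cV[R]_E := \col_i \int[mu]_x (phi x i 0 * frho x).

Lemma Lfun2_feature_comb a : feature_comb phi a \in Lfun mu 2%:E.
Proof.
rewrite (_ : feature_comb phi a = fun x => \sum_i a i 0 * phi x i 0).
  exact: (Lfun2_sum (fun i => a i 0) Lphi).
by apply/funext => x; rewrite feature_combE.
Qed.

Lemma Rintegral_feature_comb a g : g \in Lfun mu 2%:E ->
  \int[mu]_x (feature_comb phi a x * g x) =
  \sum_i a i 0 * \int[mu]_x (phi x i 0 * g x).
Proof.
move=> Lg; rewrite -(Rintegral_sum_mul (fun i => a i 0) Lphi Lg).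
by apply: eq_Rintegral => x _; rewrite feature_combE.
Qed.

Lemma gram_mul a i :
  (gram *m a) i 0 = \int[mu]_x (phi x i 0 * feature_comb phi a x).
Proof.
rewrite (_ : \int[mu]_x _ = \int[mu]_x (feature_comb phi a x * phi x i 0)).
  rewrite Rintegral_feature_comb// mxE; apply: eq_bigr => j _.
  rewrite mxE mulrC; congr (_ * _).
  by apply: eq_Rintegral => x _; rewrite mulrC.
by apply: eq_Rintegral => x _; rewrite mulrC.
Qed.

Lemma qform_gram a : qform gram a =
  \int[mu]_x (feature_comb phi a x * feature_comb phi a x).
Proof.
rewrite Rintegral_feature_comb ?Lfun2_feature_comb// qform_mulmx.
by apply: eq_bigr => i _; rewrite gram_mul.
Qed.

Lemma qform_gram_ge0 a : 0 <= qform gram a.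
Proof. by rewrite qform_gram Rintegral_ge0// => x _; rewrite -expr2 sqr_ge0. Qed.

Lemma qform_gram_le a M : 0 <= M ->
  (forall x, input_space X x -> feature_comb phi a x ^+ 2 <= M) ->
  qform gram a <= M.
Proof.
move=> M0 fM; rewrite qform_gram -lee_fin.
have Lf := Lfun2_feature_comb a.
rewrite (_ : \int[mu]_x _ = \int[mu]_x (feature_comb phi a x ^+ 2)); last first.
  by apply: eq_Rintegral => x _; rewrite expr2.
have mf2 : measurable_fun [set: R] (fun x => (feature_comb phi a x ^+ 2)%:E).
  apply/measurable_EFinP; apply: measurable_funX.
  exact: (measurable_Lfun2 Lf).
have mD := measurable_input_space X.
rewrite -EFin_Rintegral_sqr// -(integral_input_space hX mf2).
apply: (@le_trans _ _ (\int[mu]_(x in input_space X) (cst M%:E x))%E).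
  apply: ge0_le_integral => //.
  - by move=> x _; rewrite lee_fin sqr_ge0.
  - exact: measurable_funTS.
rewrite integral_cst// -[leRHS]mule1 lee_wpmul2l ?lee_fin//.
exact: probability_le1.
Qed.

Lemma squared_error a : \int[mu]_x ((feature_comb phi a x - frho x) ^+ 2) =
  qform gram a - 2 * dotc a cross + \int[mu]_x (frho x * frho x).
Proof.
rewrite Rintegral_sqrB ?Lfun2_feature_comb// qform_gram dotcE.
rewrite (Rintegral_feature_comb a Lfrho); congr (_ - _ * _ + _).
by apply: eq_bigr => i _; rewrite mxE.
Qed.

Lemma population_estimatorE : population_estimator hX phi lam gamma frho =
  feature_comb phi (ridge_coef lam gamma gram cross).
Proof.
apply: (argmin_ridge lam_gt0 gamma_gt0 (c := \int[mu]_x (frho x * frho x))) => //.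
- apply/matrixP => i j; rewrite !mxE.
  by apply: eq_Rintegral => x _; rewrite mulrC.
- exact: qform_gram_ge0.
- move=> a; rewrite /population_objective -squared_error; congr (fine _ + _).
  rewrite integral_input_space//; apply/measurable_EFinP.
  apply: measurable_funX; apply: measurable_funB.
    exact: measurable_Lfun2 (Lfun2_feature_comb a).
  exact: measurable_Lfun2 Lfrho.
Qed.

(** The normal equations give [dotc aH cross = qform gram aH] plus [gamma] times the
    penalty of [aH], so that the excess [qform gram aH - 2 * dotc aH cross] of
    the left-hand side is nonpositive. *)
Lemma population_bias_le :
  \int[mu]_x ((frho x - feature_comb phi (ridge_coef lam gamma gram cross) x) ^+ 2)
  <= \int[mu]_x (frho x * frho x).
Proof.
set aH := ridge_coef _ _ _ _.
rewrite (_ : \int[mu]_x _ = \int[mu]_x ((feature_comb phi aH x - frho x) ^+ 2)).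
  rewrite squared_error gerDr.
  have -> : dotc aH cross =
      qform gram aH + gamma * \sum_i aH i 0 ^+ 2 / lam 0 i.
    rewrite dotcE -qform_ridge_matrix qform_mulmx; apply: eq_bigr => i _.
    by rewrite mulKVmx// ridge_matrix_unit//; exact: qform_gram_ge0.
  have := qform_gram_ge0 aH; have := penalty_ge0 lam_gt0 aH.
  by move=> /(mulr_ge0 (ltW gamma_gt0)); lra.
by apply: eq_Rintegral => x _; rewrite -sqrrN opprB.
Qed.

End population.

End estimators.

(** * Residuals of the regression function and their sample deviation *)

Section residuals.
Context (R : realType) (X : R) (hX : 0 < X).
Local Notation RR := (measurableTypeR R).
Variables (rho : probability (RR * RR)%type R) (kappa : R.-pker RR ~> RR).
Hypothesis hmarg : uniform_marginal hX rho.
Hypothesis hcond : is_conditional hX rho kappa.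
Local Notation mu := (uniform_input hX).
Local Notation frho := (regression_fun kappa).
Hypothesis Lfrho : frho \in Lfun mu 2%:E.
Hypothesis noise_fin : (noise_variance rho frho < +oo)%E.

Let mfst : measurable_fun [set: RR * RR] (fst : RR * RR -> RR).
Proof. exact: measurable_fst. Qed.

Let fst_law A : measurable A -> rho ((fst : RR * RR -> RR) @^-1` A) = mu A.
Proof. by move=> mA; exact: hmarg. Qed.

Lemma Lfun2_input (f : R -> R) : f \in Lfun mu 2%:E ->
  (fun z : RR * RR => f z.1) \in Lfun rho 2%:E.
Proof. exact: (Lfun2_preserving mfst fst_law). Qed.

Lemma Lfun2_noise : (fun z : RR * RR => z.2 - frho z.1) \in Lfun rho 2%:E.
Proof.
apply/Lfun2P; split => //; apply: measurable_funB => //.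
by apply: measurableT_comp => //; exact: measurable_Lfun2 Lfrho.
Qed.

Lemma Lfun2_residual (f : R -> R) : f \in Lfun mu 2%:E ->
  (fun z : RR * RR => z.2 - f z.1) \in Lfun rho 2%:E.
Proof.
move=> Lf; rewrite (_ : (fun z => _) =
    (fun z : RR * RR => z.2 - frho z.1) \+ (fun z : RR * RR => (frho \- f) z.1)).
  by apply: Lfun2D; [exact: Lfun2_noise|apply: Lfun2_input; exact: Lfun2B].
by apply/funext => z /=; ring.
Qed.

(** Integrability of the product comes from the finite noise variance. *)
Lemma noise_orthogonal (g : R -> R) : g \in Lfun mu 2%:E ->
  \int[rho]_z (g z.1 * (z.2 - frho z.1)) = 0.
Proof.
move=> Lg; apply: (conditionally_centered hcond (Y := idfun)) => //.
exact: (Lfun2_integrableM (Lfun2_input Lg) Lfun2_noise).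
Qed.

Lemma residual_moment (g f : R -> R) : g \in Lfun mu 2%:E -> f \in Lfun mu 2%:E ->
  \int[rho]_z (g z.1 * (z.2 - f z.1)) = \int[mu]_x (g x * (frho x - f x)).
Proof.
move=> Lg Lf; have Lff := Lfun2B Lfrho Lf.
rewrite (Rintegral_preserving mfst fst_law); last first.
  apply: measurable_funM; first exact: measurable_Lfun2 Lg.
  exact: measurable_Lfun2 Lff.
rewrite -[RHS]add0r -(noise_orthogonal Lg).
rewrite -(Rintegral_mulD (Lfun2_input Lg) Lfun2_noise (Lfun2_input Lff)).
by apply: eq_Rintegral => z _ /=; ring.
Qed.

(** Pythagoras: the noise is orthogonal to the function [f - frho] of the
    input. *)
Lemma residual_second_moment (f : R -> R) : f \in Lfun mu 2%:E ->
  \int[rho]_z ((z.2 - f z.1) ^+ 2) =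
  \int[rho]_z ((z.2 - frho z.1) ^+ 2) + \int[mu]_x ((frho x - f x) ^+ 2).
Proof.
move=> Lf; have Lff : (fun x => f x - frho x) \in Lfun mu 2%:E := Lfun2B Lf Lfrho.
transitivity (\int[rho]_z ((z.2 - frho z.1 - (f z.1 - frho z.1)) ^+ 2)).
  by apply: eq_Rintegral => z _; congr (_ ^+ 2); ring.
rewrite (Rintegral_sqrB Lfun2_noise (Lfun2_input Lff)).
rewrite (_ : \int[rho]_z ((z.2 - frho z.1) * (f z.1 - frho z.1)) = 0); last first.
  rewrite -[RHS](noise_orthogonal Lff).
  by apply: eq_Rintegral => z _; rewrite mulrC.
rewrite mulr0 subr0; congr (_ + _).
rewrite (Rintegral_preserving mfst fst_law).
  by apply: eq_Rintegral => z _; rewrite /=; ring.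
by apply/measurable_funX/measurable_Lfun2/(Lfun2B Lfrho Lf).
Qed.

(** An inequality that holds on the input interval is enough, since the
    first coordinate lies in it almost surely. *)
Lemma integral_input_le (g h : R -> R) (r : RR * RR -> R) :
  measurable_fun [set: R] g -> measurable_fun [set: R] h ->
  measurable_fun [set: RR * RR] r ->
  (forall x, 0 <= g x) -> (forall x, 0 <= h x) ->
  (forall x, input_space X x -> g x <= h x) ->
  (\int[rho]_z (g z.1 * r z ^+ 2)%:E <= \int[rho]_z (h z.1 * r z ^+ 2)%:E)%E.
Proof.
move=> mg mh mr g0 h0 gh.
have mgr (k : R -> R) : measurable_fun [set: R] k ->
    measurable_fun [set: RR * RR] (fun z : RR * RR => (k z.1 * r z ^+ 2)%:E).
  move=> mk; apply/measurable_EFinP; apply: measurable_funM.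
    exact: measurableT_comp.
  exact: measurable_funX.
apply: ae_ge0_le_integral => //.
- by move=> z _; rewrite lee_fin mulr_ge0 ?sqr_ge0.
- exact: mgr.
- by move=> z _; rewrite lee_fin mulr_ge0 ?sqr_ge0.
- exact: mgr.
have mD := measurable_input_space X.
exists ((fst : RR * RR -> RR) @^-1` (~` input_space X)); split.
- by rewrite -[X in measurable X]setTI; apply: mfst => //; exact: measurableC.
- apply: etrans (fst_law _) (uniform_input_outside hX).
  exact: measurableC.
- move=> z /= zN zD; apply: zN => _.
  by rewrite lee_fin ler_wpM2r ?sqr_ge0 ?gh.
Qed.

End residuals.

Section expected_deviation.
Context (R : realType) (X : R) (hX : 0 < X).
Local Notation RR := (measurableTypeR R).
Variables (rho : probability (RR * RR)%type R) (kappa : R.-pker RR ~> RR).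
Hypothesis hmarg : uniform_marginal hX rho.
Hypothesis hcond : is_conditional hX rho kappa.
Local Notation mu := (uniform_input hX).
Local Notation frho := (regression_fun kappa).
Hypothesis Lfrho : frho \in Lfun mu 2%:E.
Hypothesis noise_fin : (noise_variance rho frho < +oo)%E.
Variables (E : nat) (phi : R -> 'cV[R]_E) (lam : 'rV[R]_E) (B : R).
Hypothesis lam_gt0 : forall i, 0 < lam 0 i.
Hypothesis mphi : forall i, measurable_fun [set: R] (fun x => phi x i 0).
Hypothesis phiB : forall i x, `|phi x i 0| <= B.
Context d (Omega : measurableType d) (P : probability Omega R) (N : nat).
Variable Z : 'I_N -> {RV P >-> (RR * RR)%type}.
Hypothesis N_gt0 : (0 < N)%N.
Hypothesis hZ : iid_sample Z rho.

Lemma Lfun2_feature i : (fun x => phi x i 0) \in Lfun mu 2%:E.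
Proof.
rewrite (_ : (fun x => _) = (fun x => phi x i 0) \* cst 1); last first.
  by apply/funext => x /=; rewrite mulr1.
have := @Lfun2_bounded_mul _ _ _ mu B (fun x => phi x i 0) (cst 1) (mphi i).
by apply => [x|]; [exact: phiB|exact: Lfun_cst].
Qed.

Variable f : R -> R.
Hypothesis Lf : f \in Lfun mu 2%:E.

(** Up to a constant factor, the derivative of the squared loss at [f] in the
    direction of the feature [i]. *)
Definition score i (z : R * R) := phi z.1 i 0 * (z.2 - f z.1).

(** The subtracted integral is the expectation of [score i] under [rho], by
    [residual_moment]. *)
Definition deviation i w :=
  N%:R^-1 * \sum_t score i (Z t w) - \int[mu]_x (phi x i 0 * (frho x - f x)).

Let Lres := Lfun2_residual hmarg Lfrho noise_fin Lf.

Lemma Lfun2_score i : (score i : RR * RR -> R) \in Lfun rho 2%:E.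
Proof.
have mg : measurable_fun [set: RR * RR] (fun z : RR * RR => phi z.1 i 0).
  by apply: (measurableT_comp (mphi i)).
exact: (Lfun2_bounded_mul mg (fun z => phiB i z.1) Lres).
Qed.

Lemma measurable_deviation i : measurable_fun [set: Omega] (deviation i).
Proof.
apply: measurable_funB => //; apply: measurable_funM => //.
apply: measurable_sum => t.
exact: measurableT_comp (measurable_Lfun2 (Lfun2_score i)) _.
Qed.

(** The variance bound of the sample mean is applied to each feature; the
    weighted sum of the squared features is the kernel on the diagonal. *)
Lemma expected_deviation :
  (\int[P]_w (\sum_i lam 0 i * deviation i w ^+ 2)%:E <=
   (N%:R^-1 * (kernel_bound phi lam (input_space X) ^+ 2 *
     (\int[rho]_z ((z.2 - frho z.1) ^+ 2)
      + \int[mu]_x ((frho x - f x) ^+ 2))))%:E)%E.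
Proof.
set CK2 := kernel_bound _ _ _ ^+ 2.
have msc i : measurable_fun [set: RR * RR] (score i).
  exact: measurable_Lfun2 (Lfun2_score i).
have step1 i : (\int[P]_w (lam 0 i * deviation i w ^+ 2)%:E <=
    N%:R^-1%:E * \int[rho]_z (lam 0 i * score i z ^+ 2)%:E)%E.
  under eq_integral do rewrite EFinM.
  rewrite ge0_integralZl_EFin ?(ltW (lam_gt0 i))//; last 2 first.
  - by move=> w _; rewrite lee_fin sqr_ge0.
  - by apply/measurable_EFinP/measurable_funX/measurable_deviation.
  under [X in (_ <= _ * X)%E]eq_integral do rewrite EFinM.
  rewrite ge0_integralZl_EFin ?(ltW (lam_gt0 i))//; last 2 first.
  - by move=> w _; rewrite lee_fin sqr_ge0.
  - exact/measurable_EFinP/measurable_funX.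
  rewrite muleCA lee_pmul2l ?lte_fin//.
  rewrite (EFin_Rintegral_sqr (Lfun2_score i)) -EFinM.
  have := sample_mean_variance hZ N_gt0 (Lfun2_score i).
  rewrite /deviation.
  rewrite -(residual_moment hmarg hcond Lfrho noise_fin (Lfun2_feature i) Lf).
  exact.
have -> : (\int[P]_w (\sum_i lam 0 i * deviation i w ^+ 2)%:E =
    \sum_i \int[P]_w (lam 0 i * deviation i w ^+ 2)%:E)%E.
  rewrite -ge0_integral_sum//.
  - by apply: eq_integral => w _; rewrite -sumEFin.
  - move=> i; apply/measurable_EFinP; apply: measurable_funM => //.
    by apply/measurable_funX/measurable_deviation.
  - by move=> i w _; rewrite lee_fin mulr_ge0 ?sqr_ge0 ?ltW.
apply: le_trans; first by apply: lee_sum => i _; exact: step1.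
rewrite -ge0_sume_distrr//; last first.
  move=> i _; apply: integral_ge0 => z _.
  by rewrite lee_fin mulr_ge0 ?sqr_ge0 ?ltW.
rewrite EFinM lee_pmul2l ?lte_fin ?invr_gt0 ?ltr0n//.
rewrite -ge0_integral_sum//; last 2 first.
- move=> i; apply/measurable_EFinP; apply: measurable_funM => //.
  exact: measurable_funX.
- by move=> i z _; rewrite lee_fin mulr_ge0 ?sqr_ge0 ?ltW.
rewrite -(residual_second_moment hmarg hcond Lfrho noise_fin Lf).
have mr : measurable_fun [set: RR * RR] (fun z : RR * RR => z.2 - f z.1).
  exact: measurable_Lfun2 Lres.
have K0 := kernel_diag_ge0 phi lam_gt0.
(* the features recombine into the kernel before it is bounded by [CK2] *)
apply: (@le_trans _ _
    (\int[rho]_z (kernel_fun phi lam z.1 z.1 * (z.2 - f z.1) ^+ 2)%:E)%E).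
  rewrite le_eqVlt; apply/orP; left; apply/eqP.
  apply: eq_integral => z _; rewrite sumEFin kernel_funE mulr_suml.
  by congr EFin; apply: eq_bigr => i _; rewrite /score; ring.
have mK : measurable_fun [set: R] (fun x => kernel_fun phi lam x x).
  under eq_fun do rewrite kernel_funE.
  apply: measurable_sum => i; apply: measurable_funM => //.
  exact: measurable_funM.
have CK20 (x : R) : 0 <= cst CK2 x by exact: sqr_ge0.
apply: le_trans.
  exact: (integral_input_le hmarg mK (measurable_cst CK2) mr K0 CK20
    (fun x => kernel_le_bound lam_gt0 phiB (x := x))).
under eq_integral do rewrite EFinM.
rewrite ge0_integralZl_EFin ?sqr_ge0//; last 2 first.
- by move=> z _; rewrite lee_fin sqr_ge0.
- exact/measurable_EFinP/measurable_funX.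
by rewrite EFin_Rintegral_sqr// EFinM.
Qed.

End expected_deviation.

Theorem theorem1 (R : realType) (X : R) (hX : 0 < X)
  (rho : probability (measurableTypeR R * measurableTypeR R)%type R)
  (kappa : R.-pker measurableTypeR R ~> measurableTypeR R)
  (hmarg : uniform_marginal hX rho)
  (hcond : is_conditional hX rho kappa)
  (m : nat) (hm : (0 < m)%N)
  (q : 'I_m -> nat) (hq0 : forall i, (0 < q i)%N) (hq : injective q)
  (lam : 'rV[R]_(m + m)) (hlam : forall i, 0 < lam 0 i)
  (Bf Bsigma : R) (hBf : 0 <= Bf) (hBsigma : 0 <= Bsigma)
  (hfrhoL2 : regression_fun kappa \in Lfun (uniform_input hX) 2%:E)
  (hfrho : ('N[uniform_input hX]_2%:E[EFin \o regression_fun kappa] <= Bf%:E)%E)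
  (hsigma : (noise_variance rho (regression_fun kappa) <= (Bsigma ^+ 2)%:E)%E)
  (gamma : R) (hgamma : 0 < gamma)
  (delta : R) (hdelta0 : 0 < delta) (hdelta1 : delta < 1)
  (N : nat) (hN : (0 < N)%N)
  (d : measure_display) (Omega : measurableType d) (P : probability Omega R)
  (Z : 'I_N -> {RV P >-> (measurableTypeR R * measurableTypeR R)%type})
  (hZ : iid_sample Z rho) :
  let phi := feature X q in
  let CK := kernel_bound phi lam (input_space X) in
  let fH := population_estimator hX phi lam gamma (regression_fun kappa) in
  let fz := fun w => empirical_estimator phi lam gamma (fun t => Z t w) in
  ((1 - delta)%:E <=
   P [set w | 'N[uniform_input hX]_2%:E[EFin \o (fz w \- fH)%R] <=
       (CK ^+ 3 / gamma *
        Num.sqrt ((Bf ^+ 2 + Bsigma ^+ 2) /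
                  (min_entry hm lam * N%:R * delta)))%:E])%E.
Proof.
cbv zeta; set phi := feature X q; set CK := kernel_bound _ _ _.
set fH := population_estimator _ _ _ _ _.
pose fz w := empirical_estimator phi lam gamma (fun t => Z t w).
set mu := uniform_input hX; set frho := regression_fun kappa.
have phi_li : linearly_independent phi by exact: feature_linearly_independent.
have mphi i : measurable_fun [set: R] (fun x => phi x i 0).
  exact: measurable_feature.
have phiB i x : `|phi x i 0| <= Num.sqrt 2 by exact: feature_bounded.
have Lphi := Lfun2_feature hX mphi phiB.
have noise_fin : (noise_variance rho frho < +oo)%E.
  exact: le_lt_trans hsigma (ltry _).
pose aH := ridge_coef lam gamma (gram phi hX) (cross phi hX frho).
have fHE : fH = feature_comb phi aH by exact: population_estimatorE.
have LfH : fH \in Lfun mu 2%:E by rewrite fHE; exact: Lfun2_feature_comb.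
pose G w := empirical_gram phi (fun t => Z t w).
pose b w := empirical_cross phi (fun t => Z t w).
pose e w := ridge_coef lam gamma (G w) (b w) - aH.
have errE w : fz w \- fH = feature_comb phi (e w).
  apply/funext => x; rewrite feature_combB -fHE /=; congr (_ - _).
  by rewrite /fz empirical_estimatorE.
have G0 w a : 0 <= qform (G w) a by exact: qform_empirical_gram_ge0.
pose dev := deviation hX kappa phi Z fH.
(* the residual of [aH] in the empirical normal equations is the deviation,
   because [aH] solves the population ones *)
have devE w i : b w i 0 - (G w *m aH) i 0 - gamma * (aH i 0 / lam 0 i) =
    dev i w.
  have := ridge_normal_equation hlam hgamma (cross phi hX frho) i
    (qform_gram_ge0 Lphi).
  rewrite -/aH (gram_mul Lphi) -fHE [cross _ _ _ _ _]mxE => gE.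
  have scoreE : b w i 0 - (G w *m aH) i 0 =
      N%:R^-1 * \sum_t score phi fH i (Z t w).
    rewrite empirical_gram_mul mxE -mulrBr -sumrB -fHE; congr (_ * _).
    by apply: eq_bigr => t _; rewrite /score; ring.
  rewrite scoreE /dev /deviation; congr (_ - _).
  rewrite -[LHS](addKr (\int[mu]_x (phi x i 0 * fH x))) gE.
  rewrite (_ : \int[mu]_x (phi x i 0 * frho x) =
    \int[mu]_x (phi x i 0 * ((frho x - fH x) + fH x))); last first.
    by apply: eq_Rintegral => x _; rewrite subrK.
  rewrite (Rintegral_mulD (Lphi i) (Lfun2B hfrhoL2 LfH) LfH).
  by rewrite addrC addrK.
have mdev i : measurable_fun [set: Omega] (dev i).
  exact: (measurable_deviation hmarg hfrhoL2 noise_fin mphi phiB Z LfH).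
have mZ1 i t : measurable_fun [set: Omega] (fun w => phi (Z t w).1 i 0).
  by apply: (measurableT_comp (mphi i)); apply: measurableT_comp.
have me i : measurable_fun [set: Omega] (fun w => e w i 0).
  rewrite (_ : (fun w => _) = fun w => ridge_coef lam gamma (G w) (b w) i 0 -
      aH i 0); last by apply/funext => w; rewrite !mxE.
  apply: measurable_funB => //; apply: measurable_ridge_coef => //.
  - move=> j k; under eq_fun do rewrite mxE.
    apply: measurable_funM => //; apply: measurable_sum => t.
    exact: measurable_funM.
  - move=> j; under eq_fun do rewrite mxE.
    apply: measurable_funM => //; apply: measurable_sum => t.
    by apply: measurable_funM => //; apply: measurableT_comp.
pose Q w := \sum_i lam 0 i * dev i w ^+ 2.
(* the level at which Markov's inequality has failure probability [delta] *)
pose c := CK ^+ 2 * (Bf ^+ 2 + Bsigma ^+ 2) / (N%:R * delta).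
have mQ : measurable_fun [set: Omega] Q.
  apply: measurable_sum => i; apply: measurable_funM => //.
  exact: measurable_funX.
have EQ : (\int[P]_w (Q w)%:E <= (delta * c)%:E)%E.
  apply: le_trans.
    exact: (expected_deviation hmarg hcond hfrhoL2 noise_fin
      hlam mphi phiB hN hZ LfH).
  rewrite lee_fin.
  have -> : delta * c = N%:R^-1 * (CK ^+ 2 * (Bsigma ^+ 2 + Bf ^+ 2)).
    by rewrite /c; field; rewrite pnatr_eq0 -lt0n hN gt_eqF.
  rewrite ler_wpM2l ?invr_ge0// ler_wpM2l ?sqr_ge0// lerD//.
    rewrite -lee_fin -EFin_Rintegral_sqr//.
    exact: (Lfun2_noise hfrhoL2 noise_fin).
  apply: (@le_trans _ _ (\int[mu]_x (frho x * frho x))).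
    rewrite fHE; exact: (population_bias_le hlam hgamma Lphi hfrhoL2).
  rewrite (_ : \int[mu]_x _ = \int[mu]_x (frho x ^+ 2)); last first.
    by apply: eq_Rintegral => x _; rewrite expr2.
  move: hfrho; rewrite Lnorm2E// lee_fin => sB.
  rewrite -[leLHS]sqr_sqrtr ?ler_pXn2r ?nnegrE ?sqrtr_ge0//.
  by apply: Rintegral_ge0 => x _; rewrite sqr_ge0.
have Q0 w : 0 <= Q w.
  by apply: sumr_ge0 => i _; rewrite mulr_ge0 ?sqr_ge0 ?ltW.
have CK0 : 0 <= CK.
  exact: (kernel_bound_ge0 hlam phiB (input_space0 hX)).
have normE w : ('N[mu]_2%:E[EFin \o (fz w \- fH)%R] =
    (Num.sqrt (qform (gram phi hX) (e w)))%:E)%E.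
  rewrite errE Lnorm2E ?Lfun2_feature_comb// qform_gram//.
have norm_le w : qform (gram phi hX) (e w) <= CK ^+ 2 * (Q w / gamma ^+ 2).
  have hQ : \sum_i e w i 0 ^+ 2 / lam 0 i <= Q w / gamma ^+ 2.
    rewrite ler_pdivlMr ?exprn_gt0// mulrC.
    apply: le_trans (ridge_perturbation hlam hgamma (b w) aH (G0 w)) _.
    by apply: ler_sum => i _; rewrite devE.
  apply: (qform_gram_le Lphi) => [|x Dx].
    by rewrite mulr_ge0 ?sqr_ge0// divr_ge0 ?sqr_ge0.
  apply: le_trans (feature_comb_sqr_le phi hlam (e w) x) _.
  rewrite ler_pM// ?penalty_ge0 ?kernel_diag_ge0//.
  exact: (kernel_le_bound hlam phiB Dx).
have c0 : 0 <= c.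
  by rewrite divr_ge0 ?mulr_ge0 ?addr_ge0 ?sqr_ge0// ltW.
apply: le_trans (markov_confidence mQ Q0 c0 hdelta0 EQ) _.
apply: le_measure; rewrite ?inE.
- rewrite -[X in measurable X]setTI.
  exact: measurable_fun_le measurableT mQ (measurable_cst c).
- set C := CK ^+ 3 / gamma * _.
  rewrite (_ : [set w | _] =
      [set: Omega] `&` [set w | Num.sqrt (qform (gram phi hX) (e w)) <= C]).
    apply: measurable_fun_le => //.
    apply: (measurableT_comp (continuous_measurable_fun (@sqrt_continuous R))).
    under eq_fun do rewrite qformE.
    apply: measurable_sum => i; apply: measurable_sum => j.
    by apply: measurable_funM => //; exact: measurable_funM.
  by rewrite setTI; apply/seteqP; split => w /=; rewrite normE lee_fin.
- move=> w /= Qc; rewrite normE lee_fin.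
  set S := _ + _; set l := min_entry hm lam.
  have l0 : 0 < l by exact: min_entry_gt0.
  have lCK : l <= CK ^+ 2 by exact: min_entry_le_kernel_bound.
  have N0 : 0 < N%:R :> R by rewrite ltr0n.
  have S0 : 0 <= S by rewrite addr_ge0 ?sqr_ge0.
  have -> : CK ^+ 3 / gamma * Num.sqrt (S / (l * N%:R * delta)) =
      Num.sqrt ((CK ^+ 3 / gamma) ^+ 2 * (S / (l * N%:R * delta))).
    rewrite [RHS]sqrtrM ?sqr_ge0// sqrtr_sqr ger0_norm// divr_ge0 ?exprn_ge0//.
    exact: ltW.
  apply: ler_wsqrtr; apply: le_trans (norm_le w) _.
  (* below the square roots, the stated bound is larger by [CK ^+ 2 / l >= 1] *)
  apply: (@le_trans _ _ (CK ^+ 2 * (c / gamma ^+ 2))).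
    by rewrite ler_wpM2l ?sqr_ge0// ler_wpM2r ?invr_ge0 ?sqr_ge0.
  have -> : CK ^+ 2 * (c / gamma ^+ 2) =
      CK ^+ 4 * S / (gamma ^+ 2 * (N%:R * delta)).
    by rewrite /c -/S; field; rewrite !gt_eqF.
  have -> : (CK ^+ 3 / gamma) ^+ 2 * (S / (l * N%:R * delta)) =
      CK ^+ 4 * S / (gamma ^+ 2 * (N%:R * delta)) * (CK ^+ 2 / l).
    by field; rewrite !gt_eqF.
  rewrite ler_peMr//; last by rewrite ler_pdivlMr// mul1r.
  by rewrite divr_ge0 ?mulr_ge0 ?exprn_ge0 ?(ltW hgamma) ?(ltW N0) ?(ltW hdelta0).
Qed.
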